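(* Let $T:C_6\to C_6$ be a triple automorphism. Then $$\operatorname{dt}T(x)=\operatorname{dt}x\cdot\operatorname{dt}T(\mathbf 1)\quad\text{for all }x\in C_6.$$
   Context: Cayley–Dickson algebras: $\mathcal A_0=\mathbb C$ with its usual product, $x^{\diamond}=x$, $x^*=\overline{x}$. Inductively $\mathcal A_{n+1}=\mathcal A_n\times\mathcal A_n$ with $\overline{(x_1,x_2)}=(\overline{x_1},\overline{x_2})$, $(x_1,x_2)^{\diamond}=(x_1^{\diamond},-x_2)$, $(x_1,x_2)^*=(x_1^*,-\overline{x_2})$ and $(x_1,x_2)\boxdot(y_1,y_2)=(x_1\boxdot y_1-y_2\boxdot x_2^{\diamond},\ x_1^{\diamond}\boxdot y_2+y_1\boxdot x_2)$. Complex octonions: $\mathbb O=\mathcal A_3$. For matrices over $\mathbb O$: $(x^\diamond)_{ij}=(x_{ji})^\diamond$, $(x^* )_{ij}=(x_{ji})^*$, and $\boxdot$ is the usual matrix product. The Cartan factor of type 6 is the JB$^*$-algebra $C_6=H_3(\mathbb O)=\{x\in M_3(\mathbb O): x^{\diamond}=x\}$ with $x\circ y=\frac12(x\boxdot y+y\boxdot x)$, involution $^*$, unit $\mathbf 1$ (unit matrix) and triple product $\{x,y,z\}=(x\circ y^* )\circ z+(z\circ y^* )\circ x-(x\circ z)\circ y^*$. A triple automorphism is a complex-linear bijection preserving the triple product. $u$ is unitary if $\{u,u,x\}=x$ for all $x\in C_6$. A tripotent is $v$ with $\{v,v,v\}=v$; it is minimal if $\{x:\{v,v,x\}=x\}=\mathbb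 C v\neq\{0\}$. Tripotents $v,w$ are orthogonal if $\{v,v,w\}=0$; $v\le w$ means that $w-v$ is a tripotent orthogonal to $v$. Determinant: a unitary $u$ can be written as $u=\alpha_1p_1+\alpha_2p_2+\alpha_3p_3$ with $|\alpha_j|=1$ and mutually orthogonal minimal tripotents $p_j\le\mathbf 1$, the triple $(\alpha_j)$ being unique up to reordering; $\operatorname{dt}u:=\alpha_1\alpha_2\alpha_3$. For general $x\in C_6$ there is a unitary $u$ with $x=\{u,x,u\}$; then $x=\alpha_1u_1+\alpha_2u_2+\alpha_3u_3$ with $\alpha_j\in\mathbb R$ (unique up to reordering) and mutually orthogonal minimal tripotents $u_j\le u$. Put $\operatorname{dt}_ux=\alpha_1\alpha_2\alpha_3$ and $\operatorname{dt}x=\operatorname{dt}_ux\cdot\operatorname{dt}u$; this does not depend on the choice of $u$ and agrees with the previous definition for unitary $x$. *)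

(* Defs.v *)
From HB Require Import structures.
From mathcomp Require Import all_boot all_order all_algebra.
From mathcomp Require Import complex.
From mathcomp Require Import boolp classical_sets reals.

Set Implicit Arguments.
Unset Strict Implicit.
Unset Printing Implicit Defensive.

Import Order.TTheory GRing.Theory Num.Theory.
Local Open Scope ring_scope.
Local Open Scope complex_scope.

Section CayleyDickson.
Variable R : realType.

(* The scalars are the complex numbers R[i] at every level. *)
Fixpoint CD (n : nat) : lmodType R[i] :=
  if n is m.+1 then (CD m * CD m)%type else R[i]^o.

Fixpoint cd_bar n : CD n -> CD n :=
  match n with
  | 0 => fun x : R[i] => Num.conj x
  | m.+1 => fun x : CD m * CD m => (cd_bar x.1, cd_bar x.2)
  end.

Fixpoint cd_diam n : CD n -> CD n :=
  match n with
  | 0 => fun x => x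
  | m.+1 => fun x : CD m * CD m => (cd_diam x.1, - x.2)
  end.

Fixpoint cd_star n : CD n -> CD n :=
  match n with
  | 0 => fun x : R[i] => Num.conj x
  | m.+1 => fun x : CD m * CD m => (cd_star x.1, - cd_bar x.2)
  end.

Fixpoint cd_mul n : CD n -> CD n -> CD n :=
  match n with
  | 0 => fun x y : R[i] => x * y
  | m.+1 => fun x y : CD m * CD m =>
      (cd_mul x.1 y.1 - cd_mul y.2 (cd_diam x.2),
       cd_mul (cd_diam x.1) y.2 + cd_mul y.1 x.2)
  end.

Fixpoint cd_one n : CD n :=
  match n with
  | 0 => (1 : R[i])
  | m.+1 => (cd_one m, 0)
  end.

Lemma cd_diam_linear n : linear (@cd_diam n).
Proof.
elim: n => [|n IH] c x y //=.
by congr pair; rewrite /= ?IH // opprD scalerN.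
Qed.

HB.instance Definition _ n :=
  GRing.isLinear.Build R[i] (CD n) (CD n) *:%R (@cd_diam n)
    (@cd_diam_linear n).

Lemma cd_barB n : {morph @cd_bar n : x y / x - y}.
Proof.
elim: n => [|n IH] x y /=; first exact: rmorphB.
by congr pair; rewrite /= IH.
Qed.

HB.instance Definition _ n :=
  GRing.isZmodMorphism.Build (CD n) (CD n) (@cd_bar n) (@cd_barB n).

Lemma cd_mul_bilinear n (c : R[i]) (x y z : CD n) :
  cd_mul (c *: x + y) z = c *: cd_mul x z + cd_mul y z /\
  cd_mul z (c *: x + y) = c *: cd_mul z x + cd_mul z y.
Proof.
elim: n x y z => [|n IH] x y z /=.
  by split; rewrite ?mulrDl ?mulrDr; congr (_ + _);
    [rewrite -scalerAl | exact: mulrCA].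
have IHl a b d := proj1 (IH a b d).
have IHr a b d := proj2 (IH a b d).
by split; congr pair; rewrite /= ?linearP ?IHl ?IHr ?scalerBr ?scalerDr
  ?opprD addrACA.
Qed.

Lemma cd_mulPl n c (x y z : CD n) :
  cd_mul (c *: x + y) z = c *: cd_mul x z + cd_mul y z.
Proof. by case: (cd_mul_bilinear c x y z). Qed.

Lemma cd_mulPr n c (x y z : CD n) :
  cd_mul z (c *: x + y) = c *: cd_mul z x + cd_mul z y.
Proof. by case: (cd_mul_bilinear c x y z). Qed.

Lemma cd_mulr0 n (x : CD n) : cd_mul x 0 = 0.
Proof.
by have := cd_mulPr (-1) 0 0 x; rewrite scaler0 addr0 scaleN1r addNr.
Qed.

Lemma cd_mul0r n (x : CD n) : cd_mul 0 x = 0.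
Proof.
by have := cd_mulPl (-1) 0 0 x; rewrite scaler0 addr0 scaleN1r addNr.
Qed.

Lemma cd_mulrN n (x y : CD n) : cd_mul x (- y) = - cd_mul x y.
Proof.
by have := cd_mulPr (-1) y 0 x; rewrite !scaleN1r cd_mulr0 !addr0.
Qed.

Lemma cd_mulNr n (x y : CD n) : cd_mul (- x) y = - cd_mul x y.
Proof.
by have := cd_mulPl (-1) x 0 y; rewrite !scaleN1r cd_mul0r !addr0.
Qed.

Lemma cd_diamK n : involutive (@cd_diam n).
Proof. by elim: n => [|n IH] // [x y] /=; rewrite IH opprK. Qed.

Lemma cd_diam_mul n (x y : CD n) :
  cd_diam (cd_mul x y) = cd_mul (cd_diam y) (cd_diam x).
Proof.
elim: n x y => [|n IH] x y /=; first exact: mulrC.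
congr pair; rewrite /= ?linearB /= ?IH ?cd_diamK.
  by rewrite cd_mulNr (linearN (@cd_diam n)) cd_mulrN opprK.
by rewrite !cd_mulrN opprD addrC.
Qed.

Lemma cd_diam_bar n (x : CD n) : cd_diam (cd_bar x) = cd_bar (cd_diam x).
Proof. by elim: n x => [|n IH] x //=; rewrite IH (raddfN (@cd_bar n)). Qed.

Lemma cd_diam_star n (x : CD n) : cd_diam (cd_star x) = cd_star (cd_diam x).
Proof. by elim: n x => [|n IH] x //=; rewrite IH (raddfN (@cd_bar n)). Qed.

Lemma cd_diam1 n : cd_diam (cd_one n) = cd_one n.
Proof. by elim: n => [|n IH] //=; rewrite IH oppr0. Qed.

Lemma cd_mul1 n : left_id (cd_one n) (@cd_mul n).
Proof.
elim: n => [|n IH] x /=; first exact: mul1r.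
by rewrite linear0 !cd_mulr0 subr0 addr0 cd_diam1 !IH; case: x.
Qed.

Lemma cd_mulr1 n : right_id (cd_one n) (@cd_mul n).
Proof.
elim: n => [|n IH] x /=; first exact: mulr1.
by rewrite cd_mulr0 cd_mul0r subr0 add0r IH cd_mul1; case: x.
Qed.

Definition octonion := CD 3.

End CayleyDickson.

Arguments cd_bar {R n} : simpl never.
Arguments cd_diam {R n} : simpl never.
Arguments cd_star {R n} : simpl never.
Arguments cd_mul {R n} : simpl never.
Arguments cd_one {R} n : simpl never.

Section OctonionMatrices.
Variable R : realType.

Definition octmx : Type := 'M[octonion R]_3.

HB.instance Definition _ := GRing.Zmodule.on octmx.

(* The library scales a matrix only by elements of its coefficient ring. *)
Definition octmx_scale (c : R[i]) (x : octmx) : octmx :=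
  map_mx (fun a : octonion R => c *: a) x.

Lemma octmx_scaleA a b x :
  octmx_scale a (octmx_scale b x) = octmx_scale (a * b) x.
Proof. by apply/matrixP => i j; rewrite !mxE scalerA. Qed.

Lemma octmx_scale1 : left_id 1 octmx_scale.
Proof. by move=> x; apply/matrixP => i j; rewrite !mxE scale1r. Qed.

Lemma octmx_scaleDr : right_distributive octmx_scale +%R.
Proof. by move=> a x y; apply/matrixP => i j; rewrite !mxE scalerDr. Qed.

Lemma octmx_scaleDl x : {morph octmx_scale^~ x : a b / a + b}.
Proof. by move=> a b; apply/matrixP => i j; rewrite !mxE scalerDl. Qed.

HB.instance Definition _ := GRing.Zmodule_isLmodule.Build R[i] octmx
  octmx_scaleA octmx_scale1 octmx_scaleDr octmx_scaleDl.

Definition octmx_diam (x : octmx) : octmx :=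
  \matrix_(i, j) cd_diam (x j i).

Definition octmx_star (x : octmx) : octmx :=
  \matrix_(i, j) cd_star (x j i).

Definition octmx_mul (x y : octmx) : octmx :=
  \matrix_(i, j) \sum_k cd_mul (x i k) (y k j).

Definition octmx_one : octmx :=
  \matrix_(i, j) (if i == j then cd_one 3 else 0).

Definition octmx_jordan (x y : octmx) : octmx :=
  2^-1 *: (octmx_mul x y + octmx_mul y x).

Lemma octmx_diam_linear : linear octmx_diam.
Proof. by move=> c x y; apply/matrixP => i j; rewrite !mxE linearP. Qed.

HB.instance Definition _ :=
  GRing.isLinear.Build R[i] octmx octmx *:%R octmx_diam octmx_diam_linear.

Lemma octmx_diam_mul x y :
  octmx_diam (octmx_mul x y) = octmx_mul (octmx_diam y) (octmx_diam x).
Proof.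
apply/matrixP => i j; rewrite !mxE linear_sum; apply: eq_bigr => k _.
by rewrite !mxE; exact: cd_diam_mul.
Qed.

Definition hermitian3 : pred octmx := fun x => octmx_diam x == x.

Lemma hermitian3_closed : submod_closed hermitian3.
Proof.
split=> [|c x y /eqP xh /eqP yh]; apply/eqP; first exact: linear0.
by rewrite linearP /= xh yh.
Qed.

HB.instance Definition _ := GRing.isSubmodClosed.Build R[i] octmx hermitian3
  hermitian3_closed.

Lemma hermitian3_star x : hermitian3 x -> hermitian3 (octmx_star x).
Proof.
move=> /eqP xh; apply/eqP/matrixP => i j.
by rewrite !mxE cd_diam_star -[in RHS]xh mxE.
Qed.

Lemma hermitian3_one : hermitian3 octmx_one.
Proof.
apply/eqP/matrixP => i j; rewrite !mxE eq_sym.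
by case: eqP => _; [exact: cd_diam1 | exact: linear0].
Qed.

Lemma hermitian3_jordan x y :
  hermitian3 x -> hermitian3 y -> hermitian3 (octmx_jordan x y).
Proof.
move=> /eqP xh /eqP yh; apply/eqP.
by rewrite linearZ linearD /= !octmx_diam_mul xh yh addrC.
Qed.

Record C6 := MkC6 { C6_mx :> octmx; C6_hermitian : hermitian3 C6_mx }.

HB.instance Definition _ := [isSub for C6_mx].
HB.instance Definition _ := [Choice of C6 by <:].
HB.instance Definition _ := [SubChoice_isSubLmodule of C6 by <:].

End OctonionMatrices.

Section CartanFactor6.
Variable R : realType.
Implicit Types (u v w x y z p : C6 R).

Definition jmul x y : C6 R :=
  MkC6 (hermitian3_jordan (C6_hermitian x) (C6_hermitian y)).

Definition jstar x : C6 R := MkC6 (hermitian3_star (C6_hermitian x)).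

Definition jone : C6 R := MkC6 (hermitian3_one R).

Lemma jmul1 x : jmul jone x = x.
Proof.
apply/val_inj/matrixP => i j; rewrite !mxE (bigD1 i) //=.
rewrite [X in _ + X](bigD1 j) //=.
rewrite !mxE !eqxx cd_mul1 cd_mulr1.
rewrite big1 => [|k ki]; last by rewrite !mxE eq_sym (negPf ki) cd_mul0r.
rewrite big1 => [|k kj]; last by rewrite !mxE (negPf kj) cd_mulr0.
rewrite !addr0.
have half (y : octonion R) : 2^-1 *: (y + y) = y.
  by rewrite -mulr2n -(scaler_nat 2 y) scalerA mulVf ?scale1r ?pnatr_eq0.
exact: half.
Qed.

Definition jtriple x y z : C6 R :=
  jmul (jmul x (jstar y)) z + jmul (jmul z (jstar y)) x
  - jmul (jmul x z) (jstar y).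

Definition triple_automorphism (T : {linear C6 R -> C6 R}) : Prop :=
  bijective T /\
  forall x y z, T (jtriple x y z) = jtriple (T x) (T y) (T z).

Definition unitary u : Prop := forall x, jtriple u u x = x.

Definition tripotent v : Prop := jtriple v v v = v.

Definition minimal_tripotent v : Prop :=
  [/\ tripotent v,
      [set x | jtriple v v x = x]%classic = range (fun c : R[i] => c *: v)
    & v != 0].

Definition tri_orthogonal v w : Prop := jtriple v v w = 0.

Definition tri_le v w : Prop :=
  tripotent (w - v) /\ tri_orthogonal (w - v) v.

Definition spectral_decomposition u x
    (a : 'I_3 -> R[i]) (p : 'I_3 -> C6 R) : Prop :=
  [/\ forall j, minimal_tripotent (p j),
      forall j, tri_le (p j) u,
      forall j k, j != k -> tri_orthogonal (p j) (p k)
    & x = \sum_j a j *: p j].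

(* Each of the three determinants picks, by choice, a value of the defining
   expression; 0 is the default outside the domain of the definition. *)
Definition dt_unitary u : R[i] :=
  xget 0 [set d | exists (a : 'I_3 -> R[i]) (p : 'I_3 -> C6 R),
    [/\ spectral_decomposition jone u a p,
        forall j, `|a j| = 1
      & d = \prod_j a j]]%classic.

Definition dt_at u x : R[i] :=
  xget 0 [set d | exists (a : 'I_3 -> R) (p : 'I_3 -> C6 R),
    spectral_decomposition u x (fun j => (a j)%:C) p /\
    d = \prod_j (a j)%:C]%classic.

Definition dt x : R[i] :=
  xget 0 [set d | exists u,
    [/\ unitary u, x = jtriple u x u & d = dt_at u x * dt_unitary u]]%classic.

End CartanFactor6.

Arguments jone {R}.

(* Main.v *)
Require Import Defs.
From HB Require Import structures.
From mathcomp Require Import all_boot all_order all_algebra.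
From mathcomp Require Import complex ring lra.
From mathcomp Require Import boolp classical_sets reals.

Set Implicit Arguments.
Unset Strict Implicit.
Unset Printing Implicit Defensive.

Import Order.TTheory GRing.Theory Num.Theory.
Local Open Scope ring_scope.

(** Let N be the cubic norm of H_3(O), x^# the adjoint, T the trace and
  [T(x, y) = T(x o y)]; everything rests on the adjoint identity
  [x^## = N(x) x].  A minimal tripotent p satisfies [p^# = 0]: the space
  [{p, J, p}] lies in [C p], so [z |-> p^# x z] has rank at most one, which is
  impossible for a nonzero [p^#].  Hence
  [N(a_1 p_1 + a_2 p_2 + a_3 p_3) = a_1 a_2 a_3 N(p_1 + p_2 + p_3)] for any
  minimal tripotents; when they are orthogonal and below a unitary u, the
  positive form [T(x, star y)] forces them to sum to u.  So every spectral value of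
  the determinant equals N.  Since triple automorphisms carry spectral
  decompositions to spectral decompositions, N(Tx) = N(x) N(T 1) follows.

  The choices in the definition of dt make it necessary to know that spectral
  decompositions exist.  For self-adjoint x one splits off an eigenprojection
  [(x - a)^# / T((x - a)^#)] and then a spin factor; a unitary u comes
  from a self-adjoint element by the Cayley transform; and a square root v of u
  gives, by the fundamental formula, a triple automorphism U_v with [U_v 1 = u],
  which reduces decompositions relative to u to those relative to 1. *)

(** * Octonions in coordinates *)

Section ComplexOctonions.
Variable R : realType.
Notation K := (complex R).
Notation O := (octonion R).
Implicit Types (x y z : O).

Definition oct (a b c d e f g h : K) : O := (((a, b), (c, d)), ((e, f), (g, h))).

Definition oct_re x : K := x.1.1.1.

Lemma octE x : exists a b c d e f g h, x = oct a b c d e f g h.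
Proof.
by case: x => [[[a b] [c d]] [[e f] [g h]]]; exists a, b, c, d, e, f, g, h.
Qed.

Lemma oct_addE a b c d e f g h a' b' c' d' e' f' g' h' :
  oct a b c d e f g h + oct a' b' c' d' e' f' g' h' =
  oct (a + a') (b + b') (c + c') (d + d') (e + e') (f + f') (g + g') (h + h').
Proof. by []. Qed.

Lemma oct_scaleE (k : K) a b c d e f g h :
  k *: oct a b c d e f g h =
  oct (k * a) (k * b) (k * c) (k * d) (k * e) (k * f) (k * g) (k * h).
Proof. by []. Qed.

Lemma oct_diamE a b c d e f g h :
  cd_diam (oct a b c d e f g h) =
  oct a (- b) (- c) (- d) (- e) (- f) (- g) (- h).
Proof. by []. Qed.

Lemma oct_barE a b c d e f g h :
  cd_bar (oct a b c d e f g h) =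
  oct a^* b^* c^* d^* e^* f^* g^* h^*.
Proof. by []. Qed.

(** The full multiplication table: octonion identities become polynomial identities in complex
    coordinates, which [ring] decides. *)
Lemma oct_mulE a b c d e f g h a' b' c' d' e' f' g' h' :
  cd_mul (oct a b c d e f g h) (oct a' b' c' d' e' f' g' h') =
  oct
   (a*a' - b*b' - c*c' - d*d' - e*e' - f*f' - g*g' - h*h')
   (a*b' + b*a' + d*c' - c*d' + f*e' - e*f' - h*g' + g*h')
   (a*c' - d*b' + c*a' + b*d' + g*e' + h*f' - e*g' - f*h')
   (a*d' + c*b' - b*c' + d*a' + h*e' - g*f' + f*g' - e*h')
   (a*e' - f*b' - g*c' - h*d' + e*a' + b*f' + c*g' + d*h')
   (a*f' + e*b' - h*c' + g*d' - b*e' + f*a' - d*g' + c*h')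
   (a*g' + h*b' + e*c' - f*d' - c*e' + d*f' + g*a' - b*h')
   (a*h' - g*b' + f*c' + e*d' - d*e' - c*f' + b*g' + h*a').
Proof.
rewrite /cd_mul /oct /= /cd_diam /=.
by congr pair; congr pair; congr pair; rewrite /=; ring.
Qed.

(** The complex bilinear polarisation of the multiplicative norm. It is not Hermitian; positivity
    appears only after [cd_bar] is applied to one argument. *)
Definition oct_form x y : K := oct_re (cd_mul x (cd_diam y)).

Definition octP := (oct_diamE, oct_barE, oct_mulE, oct_scaleE, oct_addE).

Ltac oct_elim x := case: (octE x) => ? [? [? [? [? [? [? [? ->]]]]]]].

Lemma cd_mulZl n c (a b : CD R n) : cd_mul (c *: a) b = c *: cd_mul a b.
Proof. by rewrite -[c *: a]addr0 cd_mulPl cd_mul0r addr0. Qed.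
Lemma cd_mulZr n c (a b : CD R n) : cd_mul a (c *: b) = c *: cd_mul a b.
Proof. by rewrite -[c *: b]addr0 cd_mulPr cd_mulr0 addr0. Qed.
Lemma cd_mulDl n (a b d : CD R n) : cd_mul (a + b) d = cd_mul a d + cd_mul b d.
Proof. by rewrite -[a]scale1r cd_mulPl !scale1r. Qed.
Lemma cd_mulDr n (a b d : CD R n) : cd_mul d (a + b) = cd_mul d a + cd_mul d b.
Proof. by rewrite -[a]scale1r cd_mulPr !scale1r. Qed.

Lemma cd_scalar_mull n c (a : CD R n) : cd_mul (c *: cd_one n) a = c *: a.
Proof. by rewrite cd_mulZl cd_mul1. Qed.
Lemma cd_scalar_mulr n c (a : CD R n) : cd_mul a (c *: cd_one n) = c *: a.
Proof. by rewrite cd_mulZr cd_mulr1. Qed.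

Lemma oct_re_mulC x y : oct_re (cd_mul x y) = oct_re (cd_mul y x).
Proof. by oct_elim x; oct_elim y; rewrite !octP /oct_re /=; ring. Qed.

Lemma oct_re_mulA x y z :
  oct_re (cd_mul (cd_mul x y) z) = oct_re (cd_mul x (cd_mul y z)).
Proof. by oct_elim x; oct_elim y; oct_elim z; rewrite !octP /oct_re /=; ring. Qed.

Lemma oct_mul_diam_l x y :
  cd_mul (cd_diam x) (cd_mul x y) = oct_form x x *: y.
Proof.
by oct_elim x; oct_elim y; rewrite /oct_form !octP /oct_re /=; congr oct; ring.
Qed.

Lemma oct_mul_diam_r x y :
  cd_mul (cd_mul y x) (cd_diam x) = oct_form x x *: y.
Proof.
by oct_elim x; oct_elim y; rewrite /oct_form !octP /oct_re /=; congr oct; ring.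
Qed.

(** Combines the middle Moufang identity (xy)(zx) = x w x, where w = yz, with x w x = 2 Re(xw) x -
    n(x) w^diamond. *)
Lemma oct_moufang x y z :
  cd_mul (cd_mul x y) (cd_mul z x) + oct_form x x *: cd_diam (cd_mul y z) =
  (2 * oct_re (cd_mul x (cd_mul y z))) *: x.
Proof.
oct_elim x; oct_elim y; oct_elim z.
rewrite /oct_form !(oct_mulE, oct_diamE) !oct_scaleE oct_addE /oct_re /=.
by congr oct; ring.
Qed.

Lemma oct_reD x y : oct_re (x + y) = oct_re x + oct_re y.
Proof. by oct_elim x; oct_elim y; rewrite oct_addE. Qed.

Lemma oct_reZ (c : K) x : oct_re (c *: x) = c * oct_re x.
Proof. by oct_elim x; rewrite oct_scaleE. Qed.

Lemma oct_re_diam x : oct_re (cd_diam x) = oct_re x.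
Proof. by []. Qed.

Lemma oct_addr_diam x : x + cd_diam x = (2 * oct_re x) *: cd_one 3.
Proof.
oct_elim x; rewrite oct_diamE oct_addE /oct_re /=.
have -> : cd_one 3 = oct 1 0 0 0 0 0 0 0 by [].
by rewrite oct_scaleE; congr oct; ring.
Qed.

Lemma oct_diam_fixed x : cd_diam x = x -> x = oct_re x *: cd_one 3.
Proof.
move=> xh; have := oct_addr_diam x; rewrite xh => e.
by apply: (@scalerI K _ 2); rewrite ?pnatr_eq0 // scalerA scaler_nat mulr2n.
Qed.

Lemma oct_formC x y : oct_form x y = oct_form y x.
Proof. by rewrite /oct_form -oct_re_diam cd_diam_mul cd_diamK. Qed.

Lemma oct_form_diam x y : oct_form (cd_diam x) (cd_diam y) = oct_form x y.
Proof.
by rewrite /oct_form cd_diamK oct_re_mulC -oct_re_diam cd_diam_mul cd_diamK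
  oct_re_mulC.
Qed.

Lemma oct_form_subZ (a : K) x y :
  oct_form (x - a *: y) (x - a *: y) =
  oct_form x x - 2 * a * oct_form x y + a ^+ 2 * oct_form y y.
Proof.
rewrite -scaleNr; oct_elim x; oct_elim y; rewrite oct_scaleE oct_addE.
by rewrite /oct_form !oct_diamE !oct_mulE /oct_re /=; ring.
Qed.

(** The composition law: real parts associate, so (xy) y^diamond may be formed first, and
    alternativity collapses it to n(y) x. *)
Lemma oct_form_mul x y :
  oct_form (cd_mul x y) (cd_mul x y) = oct_form x x * oct_form y y.
Proof.
rewrite {1}/oct_form cd_diam_mul -oct_re_mulA oct_mul_diam_r.
by rewrite cd_mulZl oct_reZ mulrC.
Qed.

(** The diagonal entry at [a] of the adjoint identity, for diagonal a, b, c and opposite entries x,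
    y, z. The composition law cancels the term n(y) n(z). *)
Lemma oct_adjoint_diag (a b c : K) x y z :
  (c * a - oct_form y y) * (a * b - oct_form z z)
   - oct_form (cd_diam (cd_mul y z) - a *: x) (cd_diam (cd_mul y z) - a *: x) =
  (a * b * c + 2 * oct_re (cd_mul x (cd_mul y z)) - a * oct_form x x
    - b * oct_form y y - c * oct_form z z) * a.
Proof.
rewrite oct_form_subZ oct_form_diam oct_form_mul.
have -> : oct_form (cd_diam (cd_mul y z)) x = oct_re (cd_mul x (cd_mul y z)).
  by rewrite /oct_form -cd_diam_mul oct_re_diam.
by ring.
Qed.

(** Stated in an arbitrary module so that the octonion operations stay opaque during the
    rearrangement. *)
Lemma adjoint_combination (V : lmodType K) (a b c s n1 n2 n3 : K) (v w : V) :
  (2 * s) *: v - n1 *: w - b *: (n2 *: v) - c *: (n3 *: v) + (b * c) *: w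
   - (b * c - n1) *: (w - a *: v)
  = (a * b * c + 2 * s - a * n1 - b * n2 - c * n3) *: v.
Proof.
rewrite scalerBr !scalerA opprB !addrA.
rewrite [LHS](ACl ((1*3*4*6)*(5*2*7))) /= -!scalerBl -!scalerDl.
have -> : b * c - n1 - (b * c - n1) = 0 by ring.
by rewrite scale0r addr0; congr (_ *: _); ring.
Qed.

Lemma off_combination (V : lmodType K) (a a' b b' : K) (r r' u v s1 s2 s3 s4 : V) :
  s1 = a *: r' -> s2 = b' *: r -> s3 = a' *: r -> s4 = b *: r' ->
  s1 + s2 + u + (s3 + s4 + v) = (a + b) *: r' + (a' + b') *: r + (v + u).
Proof.
by move=> -> -> -> ->; rewrite [LHS](AC (3*3) ((1*5)*(4*2)*(6*3))) /= -!scalerDl.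
Qed.

(** The off-diagonal entry at [x] of the adjoint identity. Of the four products in the expansion,
    alternativity settles (xy) y^diamond and z^diamond (zx), and the Moufang identity settles
    (xy)(zx). *)
Lemma oct_adjoint_off (a b c : K) x y z :
  cd_diam (cd_mul (cd_diam (cd_mul z x) - b *: y) (cd_diam (cd_mul x y) - c *: z))
   - (b * c - oct_form x x) *: (cd_diam (cd_mul y z) - a *: x) =
  (a * b * c + 2 * oct_re (cd_mul x (cd_mul y z)) - a * oct_form x x
    - b * oct_form y y - c * oct_form z z) *: x.
Proof.
have bilin u v u' v' : cd_mul (u - c *: v) (u' - b *: v') = cd_mul u u'
    - b *: cd_mul u v' - c *: cd_mul v u' + (b * c) *: cd_mul v v' :> O.
  rewrite -!scaleNr cd_mulDl (cd_mulZl (- c)) !cd_mulDr !(cd_mulZr (- b)).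
  by rewrite scalerDr scalerA mulrNN [c * b]mulrC !addrA.
have diamB u v d : cd_diam (u - d *: v) = cd_diam u - d *: cd_diam v :> O.
  rewrite -!scaleNr; oct_elim u; oct_elim v.
  by rewrite (oct_scaleE (- d)) oct_addE !oct_diamE oct_scaleE oct_addE; congr oct; ring.
rewrite cd_diam_mul !diamB !cd_diamK bilin oct_mul_diam_r oct_mul_diam_l.
have := oct_moufang x y z; rewrite -cd_diam_mul.
move: (cd_diam (cd_mul y z)) (cd_mul (cd_mul x y) _) (oct_re _) => D A s.
move: (oct_form x x) (oct_form y y) (oct_form z z) => n1 n2 n3.
move/(canRL (addrK _)) => ->; exact: adjoint_combination.
Qed.

Lemma oct_jordan_diag (a a' : K) (p p' q q' : O) :
  oct_re (2^-1 *:
    (cd_mul (a *: cd_one 3) (a' *: cd_one 3) + cd_mul p (cd_diam p')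
       + cd_mul (cd_diam q) q'
     + (cd_mul (a' *: cd_one 3) (a *: cd_one 3) + cd_mul p' (cd_diam p)
       + cd_mul (cd_diam q') q))) = a * a' + oct_form q q' + oct_form p p'.
Proof.
have flip (c d : O) : oct_re (cd_mul (cd_diam c) d) = oct_form d c.
  exact: oct_re_mulC.
have -> : cd_one 3 = oct 1 0 0 0 0 0 0 0 by [].
rewrite oct_reZ !oct_reD (flip q) (flip q') (oct_formC q').
rewrite -[oct_re (cd_mul p' _)]oct_formC -/(oct_form p p') !oct_scaleE !oct_mulE.
by rewrite /oct_re /=; field.
Qed.

Lemma oct_jordan_off (a a' b b' : K) (p p' q q' r r' : O) :
  cd_mul (a *: cd_one 3) r' + cd_mul r (b' *: cd_one 3)
    + cd_mul (cd_diam p) (cd_diam q')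
  + (cd_mul (a' *: cd_one 3) r + cd_mul r' (b *: cd_one 3)
    + cd_mul (cd_diam p') (cd_diam q)) =
  (a + b) *: r' + (a' + b') *: r
    + (cd_diam (cd_mul q p') + cd_diam (cd_mul q' p)).
Proof.
rewrite !cd_diam_mul; move: (cd_diam p) (cd_diam p') (cd_diam q) (cd_diam q').
move=> {p p' q q'} p p' q q'; move: (cd_mul p q') (cd_mul p' q) => {p p' q q'} u v.
exact: (off_combination u v (cd_scalar_mull a r') (cd_scalar_mulr b' r)
  (cd_scalar_mull a' r) (cd_scalar_mulr b r')).
Qed.

(** In coordinates the value is the sum of the squared moduli of the eight complex components. *)
Lemma oct_form_bar_ge0 x : 0 <= oct_form x (cd_bar x).
Proof.
oct_elim x; rewrite /oct_form oct_barE oct_diamE oct_mulE /oct_re /=.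
by rewrite !mulrN !opprK -!normCK !addr_ge0 // exprn_ge0.
Qed.

Lemma oct_form_bar_eq0 x : oct_form x (cd_bar x) = 0 -> x = 0.
Proof.
oct_elim x; rewrite /oct_form oct_barE oct_diamE oct_mulE /oct_re /=.
rewrite !mulrN !opprK -!normCK => /eqP.
rewrite !paddr_eq0 ?addr_ge0 ?exprn_ge0 //.
by rewrite !expf_eq0 /= !normr_eq0; do !case/andP; do !move/eqP->.
Qed.

Lemma cd_bar_mul n (x y : CD R n) :
  cd_bar (cd_mul x y) = cd_mul (cd_bar x) (cd_bar y).
Proof.
elim: n x y => [|n IH] x y; first exact: rmorphM.
rewrite /cd_bar /cd_mul /= -!/(cd_bar _) -!/(cd_mul _ _).
by congr pair; rewrite ?raddfB ?raddfD /= ?cd_diam_bar ?IH.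
Qed.

Lemma cd_starE n (x : CD R n) : cd_star x = cd_bar (cd_diam x).
Proof.
elim: n x => [|n IH] x //.
rewrite /cd_star /cd_bar /cd_diam /= -!/(cd_bar _) -!/(cd_diam _) -!/(cd_star _).
by rewrite IH raddfN.
Qed.

Lemma oct_formDl x y z : oct_form (x + y) z = oct_form x z + oct_form y z.
Proof. by rewrite /oct_form cd_mulDl oct_reD. Qed.

Lemma oct_formZl (c : K) x y : oct_form (c *: x) y = c * oct_form x y.
Proof. by rewrite /oct_form cd_mulZl oct_reZ. Qed.

Lemma oct_formBZl (a : K) x y z :
  oct_form (x - a *: y) z = oct_form x z - a * oct_form y z.
Proof. by rewrite -scaleNr oct_formDl oct_formZl mulNr. Qed.

Lemma oct_form_conj_mul x y z :
  oct_form (cd_diam (cd_mul x y)) z = oct_re (cd_mul x (cd_mul y z)).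
Proof. by rewrite /oct_form -cd_diam_mul oct_re_diam oct_re_mulC oct_re_mulA. Qed.

Lemma oct_form_sharp (a : K) x y z :
  oct_form (cd_diam (cd_mul y z) - a *: x) x =
  oct_re (cd_mul x (cd_mul y z)) - a * oct_form x x.
Proof. by rewrite oct_formBZl oct_form_conj_mul -oct_re_mulA oct_re_mulC. Qed.

Lemma oct_re_cycle x y z :
  oct_re (cd_mul x (cd_mul y z)) = oct_re (cd_mul y (cd_mul z x)).
Proof. by rewrite oct_re_mulC oct_re_mulA. Qed.

Lemma cd_barZ n (c : K) (x : CD R n) : cd_bar (c *: x) = c^* *: cd_bar x.
Proof.
elim: n x => [|n IH] x; first exact: rmorphM.
by rewrite /cd_bar /= -!/(cd_bar _) /= !IH.
Qed.

Lemma oct_form_bar x y : oct_form (cd_bar x) (cd_bar y) = (oct_form x y)^*.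
Proof.
rewrite /oct_form cd_diam_bar -cd_bar_mul.
by oct_elim (cd_mul x (cd_diam y)); rewrite oct_barE.
Qed.

Lemma cd_barK n (x : CD R n) : cd_bar (cd_bar x) = x.
Proof.
elim: n x => [|n IH] x; first exact: conjCK.
by case: x => a b; rewrite /cd_bar /= -!/(cd_bar _) /= !IH.
Qed.

Lemma oct_re_star x : oct_re (cd_star x) = (oct_re x)^*.
Proof. by oct_elim x. Qed.

End ComplexOctonions.

(** * The adjoint identity in H_3(O) *)

Section Coordinates.
Variable R : realType.
Notation K := (complex R).
Notation O := (octonion R).
Notation J := (C6 R).
Implicit Types (x y z : J) (i : 'I_3).

Lemma C6_entryC x i j : C6_mx x j i = cd_diam (C6_mx x i j).
Proof. by rewrite -[in LHS](eqP (C6_hermitian x)) mxE. Qed.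

(** Positions are named by an index and its two cyclic successors, so that one formula covers all
    three diagonal or off-diagonal entries. *)
Lemma ordS3K i : ordS (ordS (ordS i)) = i.
Proof. by apply/val_inj; case: i => [[|[|[|]]]]. Qed.

Lemma big_ordS (V : nmodType) (F : 'I_3 -> V) i :
  \sum_k F k = F i + F (ordS i) + F (ordS (ordS i)).
Proof.
transitivity (\sum_(k <- [:: i; ordS i; ordS (ordS i)]) F k); last first.
  by rewrite !big_cons big_nil addr0 addrA.
apply: perm_big; apply: uniq_perm; rewrite ?index_enum_uniq //.
  by case: i => [[|[|[|]]]].
move=> j; rewrite mem_index_enum.
by case: i j => [[|[|[|]]] ?] // [[|[|[|]]] ?].
Qed.

Definition diagc i x : K := oct_re (C6_mx x i i).
(* Off-diagonal entries are indexed by the opposite diagonal position. *)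
Definition offc i x : O := C6_mx x (ordS i) (ordS (ordS i)).

Lemma diagcD i x y : diagc i (x + y) = diagc i x + diagc i y.
Proof. by rewrite /diagc mxE oct_reD. Qed.
Lemma diagcZ i c x : diagc i (c *: x) = c * diagc i x.
Proof. by rewrite /diagc mxE oct_reZ. Qed.
Lemma offcD i x y : offc i (x + y) = offc i x + offc i y.
Proof. by rewrite /offc mxE. Qed.
Lemma offcZ i c x : offc i (c *: x) = c *: offc i x.
Proof. by rewrite /offc mxE. Qed.

Lemma C6_diagE x i : C6_mx x i i = diagc i x *: cd_one 3.
Proof. by apply: oct_diam_fixed; rewrite -C6_entryC. Qed.

Lemma C6_entrySS x i : C6_mx x i (ordS i) = offc (ordS (ordS i)) x.
Proof. by rewrite /offc ordS3K. Qed.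
Lemma C6_entryS0 x i : C6_mx x (ordS (ordS i)) i = offc (ordS i) x.
Proof. by rewrite /offc ordS3K. Qed.

Lemma diagc_jmul i x y :
  diagc i (jmul x y) = diagc i x * diagc i y
   + oct_form (offc (ordS i) x) (offc (ordS i) y)
   + oct_form (offc (ordS (ordS i)) x) (offc (ordS (ordS i)) y).
Proof.
rewrite {1}/diagc mxE [X in _ *: X]mxE [X in X + _]mxE [X in _ + X]mxE.
rewrite !(big_ordS _ i) (C6_diagE x i) (C6_diagE y i).
rewrite (C6_entryC x i (ordS i)) (C6_entryC y i (ordS i)).
rewrite (C6_entryC x (ordS (ordS i)) i) (C6_entryC y (ordS (ordS i)) i).
rewrite (C6_entrySS x i) (C6_entrySS y i) (C6_entryS0 x i) (C6_entryS0 y i).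
move: (diagc i x) (diagc i y) (offc (ordS i) x) (offc (ordS i) y).
move: (offc (ordS (ordS i)) x) (offc (ordS (ordS i)) y) => p p' a a' q q'.
exact: oct_jordan_diag.
Qed.

Lemma offc_jmul i x y :
  offc i (jmul x y) = 2^-1 *:
   ((diagc (ordS i) x + diagc (ordS (ordS i)) x) *: offc i y
   + (diagc (ordS i) y + diagc (ordS (ordS i)) y) *: offc i x
   + (cd_diam (cd_mul (offc (ordS i) x) (offc (ordS (ordS i)) y))
     + cd_diam (cd_mul (offc (ordS i) y) (offc (ordS (ordS i)) x)))).
Proof.
rewrite {1}/offc mxE [X in _ *: X]mxE [X in X + _]mxE [X in _ + X]mxE.
congr (_ *: _).
rewrite !(big_ordS _ (ordS i)) !ordS3K (C6_diagE x) (C6_diagE y).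
rewrite (C6_diagE x) (C6_diagE y).
rewrite (C6_entryC x i (ordS i)) (C6_entryC y i (ordS i)).
rewrite (C6_entryC x (ordS (ordS i)) i) (C6_entryC y (ordS (ordS i)) i).
rewrite (C6_entrySS x i) (C6_entrySS y i) (C6_entryS0 x i) (C6_entryS0 y i).
rewrite -/(offc i x) -/(offc i y).
move: (diagc (ordS i) x) (diagc (ordS i) y) (offc (ordS i) x) (offc (ordS i) y).
move: (diagc (ordS (ordS i)) x) (diagc (ordS (ordS i)) y) (offc i x) (offc i y).
move: (offc (ordS (ordS i)) x) (offc (ordS (ordS i)) y) => p p' b b' r r' a a' q q'.
by apply: oct_jordan_off.
Qed.

Lemma C6_diagSE x y : (forall i, diagc i x = diagc i y) ->
  (forall i, offc i x = offc i y) -> x = y.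
Proof.
move=> xyd xyo; apply/val_inj/matrixP => i j.
have: [|| j == i, j == ordS i | i == ordS j].
  by case: i j => [[|[|[|]]] ?] // [[|[|[|]]] ?].
case/or3P => /eqP->; first by rewrite !C6_diagE xyd.
  by rewrite !C6_entrySS xyo.
by rewrite (C6_entryC x j) (C6_entryC y j) !C6_entrySS xyo.
Qed.

Lemma diagc_jstar i x : diagc i (jstar x) = (diagc i x)^*.
Proof. by rewrite /diagc mxE oct_re_star. Qed.

Lemma offc_jstar i x : offc i (jstar x) = cd_bar (offc i x).
Proof. by rewrite /offc mxE cd_starE C6_entryC cd_diamK. Qed.

Lemma diagc_jone i : diagc i (jone : J) = 1.
Proof. by rewrite /diagc mxE eqxx. Qed.

Lemma offc_jone i : offc i (jone : J) = 0.
Proof. by rewrite /offc mxE; case: i => [[|[|[|]]] ?]. Qed.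

End Coordinates.

(** * The trace form, the adjoint and the cubic norm *)

Section CubicForm.
Variable R : realType.
Notation K := (complex R).
Notation O := (octonion R).
Notation J := (C6 R).
Implicit Types (x y z : J) (c : K) (i : 'I_3).

Lemma jmulC x y : jmul x y = jmul y x.
Proof. by apply/val_inj; rewrite /= /octmx_jordan addrC. Qed.

Lemma octmx_mulPl c (x y z : octmx R) :
  octmx_mul (c *: x + y) z = c *: octmx_mul x z + octmx_mul y z.
Proof.
apply/matrixP => i j; rewrite !mxE scaler_sumr -big_split.
by apply: eq_bigr => k _; rewrite !mxE; exact: cd_mulPl.
Qed.

Lemma octmx_mulPr c (x y z : octmx R) :
  octmx_mul z (c *: x + y) = c *: octmx_mul z x + octmx_mul z y.
Proof.
apply/matrixP => i j; rewrite !mxE scaler_sumr -big_split.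
by apply: eq_bigr => k _; rewrite !mxE; exact: cd_mulPr.
Qed.

Lemma half_combination (V : lmodType K) c (a b a' b' : V) :
  2^-1 *: (c *: a + b + (c *: a' + b')) = c *: (2^-1 *: (a + a')) + 2^-1 *: (b + b').
Proof. by rewrite addrACA scalerDr -(scalerDr c) !scalerA [c * _]mulrC. Qed.

Lemma jmulPl c x y z : jmul (c *: x + y) z = c *: jmul x z + jmul y z.
Proof.
apply/val_inj; rewrite /= /octmx_jordan octmx_mulPl octmx_mulPr.
exact: half_combination.
Qed.

Lemma jmulDl x y z : jmul (x + y) z = jmul x z + jmul y z.
Proof. by rewrite -[x]scale1r jmulPl !scale1r. Qed.

Lemma jmul0 z : jmul 0 z = 0.
Proof. by apply: (addrI (jmul 0 z)); rewrite -jmulDl !addr0. Qed.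

Lemma jmulZl c x z : jmul (c *: x) z = c *: jmul x z.
Proof. by rewrite -[c *: x]addr0 jmulPl jmul0 addr0. Qed.

Definition jtr x : K := \sum_i diagc i x.
Definition jform x y : K := jtr (jmul x y).
Definition jsharp x : J :=
  jmul x x - jtr x *: x + (2^-1 * (jtr x * jtr x - jform x x)) *: jone.
(** Euler's identity T(x, x^#) = 3 N(x) serves as the definition; [jnormE] recovers Freudenthal's
    explicit determinant. *)
Definition jnorm x : K := 3^-1 * jform x (jsharp x).

Lemma jtrD x y : jtr (x + y) = jtr x + jtr y.
Proof. by rewrite -big_split; apply: eq_bigr => i _; rewrite diagcD. Qed.

Lemma jtrZ c x : jtr (c *: x) = c * jtr x.
Proof. by rewrite mulr_sumr; apply: eq_bigr => i _; rewrite diagcZ. Qed.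

Lemma jtr1 : jtr jone = 3.
Proof.
rewrite /jtr (eq_bigr (fun=> 1)) => [|i _]; last exact: diagc_jone.
by rewrite sumr_const card_ord.
Qed.

Lemma jtrE i x : jtr x = diagc i x + diagc (ordS i) x + diagc (ordS (ordS i)) x.
Proof. exact: big_ordS. Qed.

Lemma jformE i x y : jform x y =
  diagc i x * diagc i y + diagc (ordS i) x * diagc (ordS i) y
   + diagc (ordS (ordS i)) x * diagc (ordS (ordS i)) y
  + 2 * (oct_form (offc i x) (offc i y)
   + oct_form (offc (ordS i) x) (offc (ordS i) y)
   + oct_form (offc (ordS (ordS i)) x) (offc (ordS (ordS i)) y)).
Proof. by rewrite /jform (jtrE i) !diagc_jmul !ordS3K; ring. Qed.

Lemma jformC x y : jform x y = jform y x.
Proof. by rewrite /jform jmulC. Qed.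

(** After expansion, the only terms beyond commutativity are real parts of triple octonion products,
    and these match by cyclic invariance. *)
Lemma jform_assoc x y z : jform (jmul x y) z = jform x (jmul y z).
Proof.
rewrite (jformC x) !(jformE ord0) !diagc_jmul !ordS3K !offc_jmul !ordS3K.
rewrite !(oct_formZl, oct_formDl, oct_form_conj_mul).
set i := ord0; set j := ordS i; set k := ordS j.
move: (offc i x) (offc j x) (offc k x) (offc i y) (offc j y) (offc k y).
move: (offc i z) (offc j z) (offc k z) => zi zj zk xi xj xk yi yj yk.
rewrite (oct_formC zi xi) (oct_formC zj xj) (oct_formC zk xk).
rewrite (oct_formC yi xi) (oct_formC yj xj) (oct_formC yk xk).
rewrite -(oct_re_cycle xi yj zk) -(oct_re_cycle xj yk zi) -(oct_re_cycle xk yi zj).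
rewrite (oct_re_cycle zj yk xi) (oct_re_cycle zk yi xj) (oct_re_cycle zi yj xk).
by field.
Qed.

Lemma diagc_jsharp i x : diagc i (jsharp x) =
  diagc (ordS i) x * diagc (ordS (ordS i)) x - oct_form (offc i x) (offc i x).
Proof.
rewrite /jsharp -scaleNr !diagcD !diagcZ diagc_jmul diagc_jone (jtrE i) (jformE i).
by field.
Qed.

Lemma sharp_off_combination (V : lmodType K) (a b c d : K) (v w : V) :
  2^-1 *: ((b + c) *: v + (b + c) *: v + (w + w)) + - (a + b + c) *: v + d *: 0
  = w - a *: v.
Proof.
have half (u : V) : 2^-1 *: (u + u) = u.
  by rewrite -mulr2n -(scaler_nat 2 u) scalerA mulVf ?scale1r ?pnatr_eq0.
rewrite scaler0 addr0 scalerDr !half addrAC -scalerDl addrC -scaleNr.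
by congr (_ + _ *: _); ring.
Qed.

Lemma offc_jsharp i x : offc i (jsharp x) =
  cd_diam (cd_mul (offc (ordS i) x) (offc (ordS (ordS i)) x))
  - diagc i x *: offc i x.
Proof.
rewrite /jsharp -scaleNr !offcD !offcZ offc_jmul offc_jone (jtrE i).
exact: sharp_off_combination.
Qed.

Lemma norm_combination (a b c s n1 n2 n3 f1 f2 f3 : K) :
  f1 = s - a * n1 -> f2 = s - b * n2 -> f3 = s - c * n3 ->
  3^-1 * ((b * c - n1) * a + (c * a - n2) * b + (a * b - n3) * c
    + 2 * (f1 + f2 + f3)) = a * b * c + 2 * s - a * n1 - b * n2 - c * n3.
Proof. by move=> -> -> ->; field. Qed.

Lemma jnormE i x : jnorm x =
  diagc i x * diagc (ordS i) x * diagc (ordS (ordS i)) x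
  + 2 * oct_re (cd_mul (offc i x)
      (cd_mul (offc (ordS i) x) (offc (ordS (ordS i)) x)))
  - diagc i x * oct_form (offc i x) (offc i x)
  - diagc (ordS i) x * oct_form (offc (ordS i) x) (offc (ordS i) x)
  - diagc (ordS (ordS i)) x
    * oct_form (offc (ordS (ordS i)) x) (offc (ordS (ordS i)) x).
Proof.
rewrite /jnorm jformC (jformE i).
rewrite (diagc_jsharp i) (diagc_jsharp (ordS i)) (diagc_jsharp (ordS (ordS i))).
rewrite (offc_jsharp i) (offc_jsharp (ordS i)) (offc_jsharp (ordS (ordS i))).
rewrite !ordS3K; apply: norm_combination.
- exact: oct_form_sharp.
- by rewrite oct_form_sharp oct_re_cycle oct_re_cycle.
- by rewrite oct_form_sharp oct_re_cycle.
Qed.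

Lemma jsharp_sharp x : jsharp (jsharp x) = jnorm x *: x.
Proof.
apply: C6_diagSE => i; rewrite (jnormE i).
  rewrite diagcZ (diagc_jsharp i) (diagc_jsharp (ordS i)).
  rewrite (diagc_jsharp (ordS (ordS i))) (offc_jsharp i) !ordS3K.
  exact: oct_adjoint_diag.
rewrite offcZ (offc_jsharp i) (diagc_jsharp i) (offc_jsharp (ordS i)).
rewrite (offc_jsharp (ordS (ordS i))) (offc_jsharp i) !ordS3K.
exact: oct_adjoint_off.
Qed.

End CubicForm.

(** * The conjugate-linear involution, positivity and the diagonal idempotents *)

Section Involution.
Variable R : realType.
Notation K := (complex R).
Notation O := (octonion R).
Notation J := (C6 R).
Implicit Types (x y z : J) (c : K) (i : 'I_3).

Lemma jstarD x y : jstar (x + y) = jstar x + jstar y.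
Proof.
apply: C6_diagSE => i.
  rewrite diagcD !diagc_jstar diagcD; exact: rmorphD.
rewrite offcD !offc_jstar offcD; exact: raddfD.
Qed.

Lemma jstarZ c x : jstar (c *: x) = c^* *: jstar x.
Proof.
apply: C6_diagSE => i.
  rewrite diagcZ !diagc_jstar diagcZ; exact: rmorphM.
rewrite offcZ !offc_jstar offcZ; exact: cd_barZ.
Qed.

Lemma jstarK x : jstar (jstar x) = x.
Proof.
apply: C6_diagSE => i; first by rewrite !diagc_jstar conjCK.
by rewrite !offc_jstar cd_barK.
Qed.

Lemma cd_bar0 n : cd_bar (0 : CD R n) = 0.
Proof. exact: raddf0. Qed.

Lemma bar_combination (a b c d : K) (r r' p q p' q' : O) :
  2^-1 *: ((a^* + b^*) *: cd_bar r + (c^* + d^*) *: cd_bar r'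
    + (cd_diam (cd_mul (cd_bar p) (cd_bar q))
      + cd_diam (cd_mul (cd_bar p') (cd_bar q'))))
  = cd_bar (2^-1 *: ((a + b) *: r + (c + d) *: r'
    + (cd_diam (cd_mul p q) + cd_diam (cd_mul p' q')))).
Proof.
have conj2 : (2^-1 : K)^* = 2^-1 by rewrite rmorphV ?unitfE ?pnatr_eq0 // rmorph_nat.
have barD (u v : O) : cd_bar (u + v) = cd_bar u + cd_bar v by exact: raddfD.
by rewrite cd_barZ conj2 !barD !cd_barZ -!cd_bar_mul !cd_diam_bar !rmorphD.
Qed.

Lemma conj_combination (a b c d : K) :
  a^* * b^* + c^* + d^* = (a * b + c + d)^*.
Proof. by rewrite !rmorphD rmorphM. Qed.

Lemma jstar_jmul x y : jstar (jmul x y) = jmul (jstar x) (jstar y).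
Proof.
apply: C6_diagSE => i.
  rewrite diagc_jmul !diagc_jstar !offc_jstar !oct_form_bar diagc_jmul.
  symmetry; exact: conj_combination.
rewrite offc_jmul !diagc_jstar !offc_jstar offc_jmul; symmetry.
exact: bar_combination.
Qed.

Lemma jtr_jstar x : jtr (jstar x) = (jtr x)^*.
Proof. by rewrite !(jtrE ord0) !diagc_jstar !rmorphD. Qed.

Lemma jform_star_sum x : jform x (jstar x) =
  \sum_i (`|diagc i x| ^+ 2 + 2 * oct_form (offc i x) (cd_bar (offc i x))).
Proof.
rewrite (jformE ord0) (big_ordS _ ord0) !diagc_jstar !offc_jstar !normCK.
by ring.
Qed.

Lemma jform_star_ge0 x : 0 <= jform x (jstar x).
Proof.
rewrite jform_star_sum sumr_ge0 // => i _.
by rewrite addr_ge0 ?exprn_ge0 // mulr_ge0 ?ler0n // oct_form_bar_ge0.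
Qed.

Lemma jform_star_eq0 x : jform x (jstar x) = 0 -> x = 0.
Proof.
have ge0 i : 0 <= `|diagc i x| ^+ 2 + 2 * oct_form (offc i x) (cd_bar (offc i x)).
  by rewrite addr_ge0 ?exprn_ge0 // mulr_ge0 ?ler0n // oct_form_bar_ge0.
rewrite jform_star_sum => /eqP; rewrite psumr_eq0 // => /allP x0.
have {}x0 i : diagc i x = 0 /\ offc i x = 0.
  have /eqP := x0 i (mem_index_enum i); move/eqP.
  rewrite paddr_eq0 ?exprn_ge0 ?mulr_ge0 ?ler0n ?oct_form_bar_ge0 //.
  rewrite expf_eq0 /= normr_eq0 mulf_eq0 pnatr_eq0 /=.
  by case/andP => /eqP -> /eqP /oct_form_bar_eq0.
apply: C6_diagSE => i; have [d0 o0] := x0 i.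
  by rewrite d0 -(scale0r x) diagcZ mul0r.
by rewrite o0 -(scale0r x) offcZ scale0r.
Qed.

Lemma diag_unit_hermitian i : hermitian3
  (\matrix_(j, k) (if (j == k) && (j == i) then cd_one 3 else 0) : octmx R).
Proof.
apply/eqP/matrixP => j k; rewrite !mxE [k == j]eq_sym.
have [<- | _] := eqVneq j k; last exact: linear0.
by case: (j == i); [exact: cd_diam1 | exact: linear0].
Qed.

Definition junit i : J := MkC6 (diag_unit_hermitian i).

Lemma diagc_junit i j : diagc j (junit i) = (j == i)%:R.
Proof. by rewrite /diagc mxE eqxx; case: eqP. Qed.

Lemma offc_junit i j : offc j (junit i) = 0.
Proof. by rewrite /offc mxE; case: j => [[|[|[|]]] ?]. Qed.

End Involution.

(** * Cubic Jordan algebras with a positive involution *)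

(* An abstract copy of the structure of C_6: on the concrete type, conversion
   unfolds the Cayley-Dickson tower and rewriting becomes intractable. *)
Record cubic_jordan (R : realType) := CubicJordan {
  cj_space :> lmodType (complex R);
  mul : cj_space -> cj_space -> cj_space;
  one : cj_space;
  tr : cj_space -> complex R;
  star : cj_space -> cj_space;
  idem : 'I_3 -> cj_space;
  tform := fun x y => tr (mul x y);
  mulC : forall x y, mul x y = mul y x;
  mulDl : forall x y z, mul (x + y) z = mul x z + mul y z;
  mulZl : forall c x y, mul (c *: x) y = c *: mul x y;
  mul1 : forall x, mul one x = x;
  trD : forall x y, tr (x + y) = tr x + tr y;
  trZ : forall c x, tr (c *: x) = c * tr x;
  tr1 : tr one = 3;
  tform_assoc : forall x y z, tform (mul x y) z = tform x (mul y z);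
  sharp_sharp_field :
    let sh x := mul x x - tr x *: x
      + (2^-1 * (tr x * tr x - tform x x)) *: one in
    forall x, sh (sh x) = (3^-1 * tform x (sh x)) *: x;
  starD : forall x y, star (x + y) = star x + star y;
  starZ : forall c x, star (c *: x) = c^* *: star x;
  starK : forall x, star (star x) = x;
  star_mul : forall x y, star (mul x y) = mul (star x) (star y);
  tr_star : forall x, tr (star x) = (tr x)^*;
  tform_star_ge0 : forall x, 0 <= tform x (star x);
  tform_star_eq0 : forall x, tform x (star x) = 0 -> x = 0;
  idem_sum : idem ord0 + idem (ordS ord0) + idem (ordS (ordS ord0)) = one;
  idem2 : forall i, mul (idem i) (idem i) = idem i;
  star_idem : forall i, star (idem i) = idem i;
  tr_idem : forall i, tr (idem i) = 1
}.
Arguments mul {R _}. Arguments one {R _}. Arguments tr {R _}. Arguments star {R _}.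
Arguments idem {R _}. Arguments tform {R _}.

(** The Freudenthal product, i.e. the polarisation of [sharp] with [cross x x = 2 *: sharp x]. The
    lock keeps rewriting from unfolding it. *)
HB.lock Definition cross (R : realType) (J : cubic_jordan R) (x y : J) : J :=
  2 *: mul x y - tr x *: y - tr y *: x + (tr x * tr y - tform x y) *: one.
HB.lock Definition sharp (R : realType) (J : cubic_jordan R) (x : J) : J :=
  mul x x - tr x *: x + (2^-1 * (tr x * tr x - tform x x)) *: one.
HB.lock Definition norm3 (R : realType) (J : cubic_jordan R) (x : J) : complex R :=
  3^-1 * tform x (sharp x).
(** The U-operator of the Jordan algebra, in McCrimmon's form through the adjoint. *)
HB.lock Definition quad (R : realType) (J : cubic_jordan R) (x y : J) : J :=
  tform x y *: x - cross (sharp x) y.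

(** * Identities for the adjoint, the Freudenthal product and the norm *)

Section AdjointCalculus.
Variables (R : realType) (J : cubic_jordan R).
Notation K := (complex R).
Implicit Types (x y z w : J) (c : K).

Lemma tformC x y : tform x y = tform y x.
Proof. by rewrite /tform mulC. Qed.

Lemma mulDr x y z : mul z (x + y) = mul z x + mul z y.
Proof. by rewrite mulC mulDl !(mulC z). Qed.

Lemma mulZr c x z : mul z (c *: x) = c *: mul z x.
Proof. by rewrite mulC mulZl (mulC z). Qed.

Lemma tformDl x y z : tform (x + y) z = tform x z + tform y z.
Proof. by rewrite /tform mulDl trD. Qed.

Lemma tformZl c x z : tform (c *: x) z = c * tform x z.
Proof. by rewrite /tform mulZl trZ. Qed.

Lemma tformNl x z : tform (- x) z = - tform x z.
Proof. by rewrite -scaleN1r tformZl mulN1r. Qed.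

Lemma tform0 z : tform 0 z = 0.
Proof. by rewrite -(scale0r z) tformZl mul0r. Qed.

Lemma tformDr x y z : tform z (x + y) = tform z x + tform z y.
Proof. by rewrite tformC tformDl !(tformC z). Qed.

Lemma tformZr c x z : tform z (c *: x) = c * tform z x.
Proof. by rewrite tformC tformZl (tformC z). Qed.

Lemma tformNr x z : tform z (- x) = - tform z x.
Proof. by rewrite tformC tformNl (tformC z). Qed.

Definition tform_lin := (tformDl, tformDr, tformZl, tformZr, tformNl, tformNr).

Lemma tform1 x : tform one x = tr x.
Proof. by rewrite /tform mul1. Qed.

Lemma tformr1 x : tform x one = tr x.
Proof. by rewrite tformC tform1. Qed.

(** Positivity makes the trace form nondegenerate: test against the star of x - y. Vector identities
    thereby reduce to scalar ones that [ring] or [field] can close. *)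
Lemma tform_inj x y : (forall z, tform x z = tform y z) -> x = y.
Proof.
move=> xy; apply/eqP; rewrite -subr_eq0; apply/eqP/tform_star_eq0.
by rewrite tformDl tformNl xy subrr.
Qed.

Lemma tform_crossE x y z : tform (cross x y) z =
  2 * tform (mul x y) z - tr x * tform y z - tr y * tform x z
  + (tr x * tr y - tform x y) * tr z.
Proof. by rewrite cross.unlock !tform_lin tform1. Qed.

Lemma crossC x y : cross x y = cross y x.
Proof.
by apply: tform_inj => z; rewrite !tform_crossE (mulC y x) (tformC y x); ring.
Qed.

(** The form T(x × y, z) is totally symmetric, being the polarised norm; by duality this yields the
    bilinearity of [cross]. *)
Lemma tform_crossA x y z : tform (cross x y) z = tform x (cross y z).
Proof.
rewrite (tformC x (cross y z)) !tform_crossE (tform_assoc x y z).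
by rewrite (tformC (mul y z) x) (tformC z x) (tformC y x); ring.
Qed.

Lemma crossDl x y z : cross (x + y) z = cross x z + cross y z.
Proof. by apply: tform_inj => w; rewrite !tform_lin !tform_crossA tform_lin. Qed.

Lemma crossZl c x z : cross (c *: x) z = c *: cross x z.
Proof. by apply: tform_inj => w; rewrite !tform_lin !tform_crossA tform_lin. Qed.

Lemma crossNl x z : cross (- x) z = - cross x z.
Proof. by rewrite -scaleN1r crossZl scaleN1r. Qed.

Lemma crossDr x y z : cross z (x + y) = cross z x + cross z y.
Proof. by rewrite crossC crossDl !(crossC z). Qed.

Lemma crossZr c x z : cross z (c *: x) = c *: cross z x.
Proof. by rewrite crossC crossZl (crossC z). Qed.

Lemma crossNr x z : cross z (- x) = - cross z x.
Proof. by rewrite crossC crossNl (crossC z). Qed.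

Definition cross_lin :=
  (crossDl, crossDr, crossZl, crossZr, crossNl, crossNr).

Lemma cross_self x : cross x x = 2 *: sharp x.
Proof.
apply: tform_inj => w; rewrite tform_crossE sharp.unlock !tform_lin tform1.
by field.
Qed.

Lemma sharpD x y : sharp (x + y) = sharp x + cross x y + sharp y.
Proof.
apply: (@scalerI K _ 2); rewrite ?pnatr_eq0 // -cross_self !cross_lin.
rewrite !cross_self (crossC y x) !scalerDr -!addrA; congr (_ + _).
by rewrite addrA; congr (_ + _); rewrite scaler_nat mulr2n.
Qed.

Lemma sharpZ c x : sharp (c *: x) = c ^+ 2 *: sharp x.
Proof.
apply: (@scalerI K _ 2); rewrite ?pnatr_eq0 // -cross_self !cross_lin.
by rewrite cross_self !scalerA; congr (_ *: _); ring.
Qed.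

Lemma tform_sharp x y : tform (cross x y) x = 2 * tform (sharp x) y.
Proof. by rewrite crossC tform_crossA cross_self tform_lin tformC. Qed.

Lemma norm3D x y : norm3 (x + y) =
  norm3 x + tform (sharp x) y + tform x (sharp y) + norm3 y.
Proof.
rewrite norm3.unlock sharpD !tform_lin (tformC x (cross x y)) (tformC y (cross x y)).
rewrite tform_sharp (crossC x y) tform_sharp (tformC y (sharp x)).
by rewrite (tformC (sharp y)); field.
Qed.

Lemma norm3Z c x : norm3 (c *: x) = c ^+ 3 * norm3 x.
Proof. by rewrite norm3.unlock sharpZ !tform_lin; ring. Qed.

Lemma tform_norm x : tform x (sharp x) = 3 * norm3 x.
Proof. by rewrite norm3.unlock; field. Qed.

Lemma norm31 : norm3 (one : J) = 1.
Proof.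
have e : sharp one = one :> J.
  apply: tform_inj => w; rewrite sharp.unlock !tform_lin mul1 tform1 /tform mul1 tr1.
  by field.
by rewrite norm3.unlock e tform1 tr1 mulVf ?pnatr_eq0.
Qed.

Lemma cross1 x : cross one x = tr x *: one - x.
Proof.
apply: tform_inj => w; rewrite tform_crossE !tform_lin mul1 !tform1 tr1; ring.
Qed.

Lemma sharp_sharp x : sharp (sharp x) = norm3 x *: x.
Proof. by rewrite norm3.unlock sharp.unlock sharp_sharp_field. Qed.

Lemma poly3_coefs (a b d : K) :
  (forall t : K, t * a + t ^+ 2 * b + t ^+ 3 * d = 0) -> a = 0 /\ b = 0.
Proof.
(* Lagrange interpolation at 1, -1 and 2 for a cubic polynomial vanishing at 0. *)
move=> h; have := (h 1, h (-1), h 2) => -[[h1 h2] h3]; split.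
  rewrite (_ : a = (1 * a + 1 ^+ 2 * b + 1 ^+ 3 * d)
    - 3^-1 * (-1 * a + (-1) ^+ 2 * b + (-1) ^+ 3 * d)
    - 6^-1 * (2 * a + 2 ^+ 2 * b + 2 ^+ 3 * d)); last by field.
  by rewrite h1 h2 h3 !mulr0 !subr0.
rewrite (_ : b = 2^-1 * ((1 * a + 1 ^+ 2 * b + 1 ^+ 3 * d)
    + (-1 * a + (-1) ^+ 2 * b + (-1) ^+ 3 * d))); last by field.
by rewrite h1 h2 !addr0 mulr0.
Qed.

(* Coefficients of t and t^2 in the adjoint identity for x + t y. *)
Lemma sharp_sharp_polar x y :
  cross (sharp x) (cross x y) = norm3 x *: y + tform (sharp x) y *: x /\
  cross (sharp x) (sharp y) + sharp (cross x y) =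
    tform (sharp x) y *: y + tform x (sharp y) *: x.
Proof.
pose A z := tform (cross (sharp x) (cross x y)) z
  - tform (norm3 x *: y + tform (sharp x) y *: x) z.
pose B z := tform (cross (sharp x) (sharp y) + sharp (cross x y)) z
  - tform (tform (sharp x) y *: y + tform x (sharp y) *: x) z.
pose D z := tform (cross (cross x y) (sharp y)) z
  - tform (tform x (sharp y) *: y + norm3 y *: x) z.
have ABD z t : t * A z + t ^+ 2 * B z + t ^+ 3 * D z = 0.
  have := congr1 (tform^~ z) (sharp_sharp (x + t *: y)).
  rewrite !(sharpD, sharpZ, cross_lin).
  rewrite !(sharp_sharp, norm3D, norm3Z, sharpZ, tform_lin).
  move/eqP; rewrite -subr_eq0 => /eqP e.
  rewrite -[RHS]e /A /B /D !tform_lin.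
  by ring.
split; apply: tform_inj => z; apply/eqP; rewrite -subr_eq0; apply/eqP;
  by have [] := poly3_coefs (ABD z).
Qed.

Lemma sharp_cross_cross x y :
  cross (sharp x) (cross x y) = norm3 x *: y + tform (sharp x) y *: x.
Proof. by case: (sharp_sharp_polar x y). Qed.

Lemma cross_sharps x y :
  cross (sharp x) (sharp y) + sharp (cross x y) =
  tform (sharp x) y *: y + tform x (sharp y) *: x.
Proof. by case: (sharp_sharp_polar x y). Qed.

(** The dual of [sharp_cross_cross] under the trace form: multiplication by x and by x^# under × are
    each self-adjoint, so the order of composition is reversed. *)
Lemma cross_cross_sharp x y :
  cross x (cross (sharp x) y) = norm3 x *: y + tform x y *: sharp x.
Proof.
apply: tform_inj => z.
rewrite (crossC x) tform_crossA (crossC (sharp x)) tform_crossA.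
by rewrite sharp_cross_cross !tform_lin (tformC y x); ring.
Qed.

Lemma sharp_cross x y :
  sharp (cross x y) = tform (sharp x) y *: y + tform x (sharp y) *: x
    - cross (sharp x) (sharp y).
Proof. by rewrite -cross_sharps addrAC subrr add0r. Qed.

Lemma norm3_sharp x : norm3 (sharp x) = norm3 x ^+ 2.
Proof.
have := tform_norm (sharp x); rewrite sharp_sharp tform_lin tformC tform_norm.
by move=> e; apply: (@mulfI _ 3); rewrite ?pnatr_eq0 // -e; ring.
Qed.

Lemma tr_mul x y : tr (mul x y) = tform x y.
Proof. by []. Qed.

Lemma tr_cross x y : tr (cross x y) = tr x * tr y - tform x y.
Proof. by rewrite -tformr1 tform_crossE tr1 !tformr1 tr_mul; ring. Qed.

Lemma tr_sharp x : tr (sharp x) = 2^-1 * (tr x * tr x - tform x x).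
Proof.
rewrite -tform1 sharp.unlock !tform_lin !tform1 tr1 (tr_mul x x).
by field.
Qed.

Lemma mulE x y : mul x y = 2^-1 *: (cross x y + tr x *: y + tr y *: x
  - (tr x * tr y - tform x y) *: one).
Proof.
apply: tform_inj => z; rewrite !tform_lin tform_crossE tform1.
by field.
Qed.

(** The Cayley-Hamilton equation in adjoint form; it is [sharp_cross_cross] evaluated at the
    unit. *)
Lemma mul_sharp x : mul x (sharp x) = norm3 x *: one.
Proof.
apply: tform_inj => z; have := congr1 (tform^~ z) (sharp_cross_cross x one).
rewrite (crossC x) cross1 !cross_lin (crossC _ one) cross1 (crossC _ x) mulE.
rewrite !tform_lin !tformr1 !tform1 tform_norm => h.
have -> : tform (cross x (sharp x)) z = tr x * (tr (sharp x) * tr z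
    - tform (sharp x) z) - (norm3 x * tr z + tr (sharp x) * tform x z).
  by rewrite -h; ring.
by field.
Qed.

(* The full linearization of [mul_sharp]. *)
Lemma mul_cross_polar x y z :
  mul x (cross y z) + mul y (cross x z) + mul z (cross x y) =
  tform (cross x y) z *: one.
Proof.
apply: tform_inj => w; rewrite !tform_lin tform1.
pose G v := tform (mul v (sharp v)) w - norm3 v * tr w.
have G0 v : G v = 0 by rewrite /G mul_sharp tform_lin tform1 subrr.
apply/eqP; rewrite -subr_eq0; apply/eqP.
(* The third difference of the cubic map [G] is its full polarisation, and [G] vanishes by
   [mul_sharp]. *)
transitivity (G (x + y + z) - G (x + y) - G (y + z) - G (x + z) + G x + G y + G z);
  last by rewrite !G0 !subr0 !addr0.
rewrite /G !(sharpD, cross_lin, norm3D, mulDl, mulDr, tform_lin).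
by ring.
Qed.

(** Expresses the triple product through × and the trace form by means of the linearized
    Cayley-Hamilton equation. Here y stands for the middle argument after the involution. *)
Lemma tripleE x y z :
  mul (mul x y) z + mul (mul z y) x - mul (mul x z) y =
  2^-1 *: (tform x y *: z + tform z y *: x - cross (cross x z) y).
Proof.
have e := mul_cross_polar x y z.
apply: tform_inj => w; have := congr1 (tform^~ w) e.
rewrite /= !tform_lin !tform_crossE tform1 !(mulC _ (cross _ _)).
rewrite !(tform_assoc _ _ w) !tform_crossE !tr_cross !tr_mul => /eqP.
rewrite -subr_eq0 => /eqP h; apply/eqP; rewrite -subr_eq0; apply/eqP.
rewrite -[RHS](mulr0 2^-1) -h.
have swap (a b d : J) : tform a (mul b d) = tform b (mul a d).
  by rewrite -!tform_assoc (mulC a).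
have rot (a b d : J) : tform (mul a b) d = tform (mul a d) b.
  by rewrite tform_assoc (mulC b) -tform_assoc.
rewrite (swap z x w) (swap z y w) (swap y x w) (mulC z y) (tformC z y) (rot x z y).
by field.
Qed.

End AdjointCalculus.

(** * Minimal tripotents and the norm of orthogonal sums *)

Section Triple.
Variables (R : realType) (J : cubic_jordan R).
Notation K := (complex R).
Implicit Types (u v w x y z p q : J) (c : K).

Definition triple x y z : J :=
  mul (mul x (star y)) z + mul (mul z (star y)) x - mul (mul x z) (star y).

Lemma triple_self x y : triple x y x = quad x (star y).
Proof.
rewrite /triple tripleE quad.unlock cross_self crossZl.
apply: tform_inj => w; rewrite !tform_lin; by field.
Qed.

(** The Jordan pair identity {x, y, U_x z} = {U_x y, z, x}, with linear middle argument. It will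
    place the image of U_p in the 1-eigenspace of {p, p, .} for a tripotent p. *)
Lemma quad_shift x y z :
  mul (mul x y) (quad x z) + mul (mul (quad x z) y) x - mul (mul x (quad x z)) y
  = mul (mul (quad x y) z) x + mul (mul x z) (quad x y) - mul (mul (quad x y) x) z.
Proof.
rewrite !tripleE; congr (_ *: _).
have xU a : cross x (quad x a) = tform x a *: sharp x - norm3 x *: a.
  rewrite quad.unlock !cross_lin cross_self cross_cross_sharp.
  by apply: tform_inj => w; rewrite !tform_lin; ring.
rewrite xU (crossC _ x) xU quad.unlock.
apply: tform_inj => w; rewrite !(tform_lin, cross_lin).
by rewrite (tform_crossA (sharp x) z y) (crossC z y) -(tform_crossA (sharp x) y z)
  (tform_crossA (sharp x) y z) (crossC y z); ring.
Qed.

Lemma norm3_eq0 x : sharp x = 0 -> norm3 x = 0.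
Proof.
by move=> x0; rewrite norm3.unlock x0 -(scale0r one) tform_lin mul0r mulr0.
Qed.

Lemma sharp_idem i : sharp (idem i : J) = 0.
Proof.
rewrite sharp.unlock idem2 tr_idem scale1r subrr add0r.
by rewrite /tform idem2 tr_idem mulr1 subrr mulr0 scale0r.
Qed.

Lemma sharp1 : sharp (one : J) = one.
Proof.
apply: tform_inj => w; rewrite sharp.unlock !tform_lin mul1 tform1 /tform mul1 tr1.
by field.
Qed.

(* [sharp (cross q (idem i)) = 0], so [cross q (idem i) = c *: b] forces c = 0;
   summing over i, [cross q one = tr q *: one - q] vanishes. *)
Lemma rank_one_cross q b : sharp q = 0 -> sharp b = q ->
  (forall i, exists c, cross q (idem i) = c *: b) -> q = 0.
Proof.
move=> q0 bq h; have [// | qn0] := eqVneq q 0.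
have {}h i : cross q (idem i) = 0.
  have [c e] := h i; have := sharp_cross q (idem i).
  have z x : cross 0 x = 0 by rewrite -(scale0r q) crossZl !scale0r.
  have t x : tform 0 x = 0 by rewrite -(scale0r q) tformZl mul0r.
  rewrite q0 sharp_idem z t (tformC q) t !scale0r subr0 addr0 e sharpZ bq.
  move/eqP; rewrite scaler_eq0 (negPf qn0) orbF expf_eq0 /= => /eqP->.
  by rewrite scale0r.
have: cross one q = 0.
  by rewrite crossC -idem_sum !crossDr !h !addr0.
rewrite cross1 => /eqP; rewrite subr_eq0 => /eqP e.
move: q0; rewrite -e sharpZ sharp1 => /eqP; rewrite scaler_eq0 expf_eq0 /=.
case/orP => [/eqP-> | /eqP->]; first by rewrite scale0r.
by rewrite scaler0.
Qed.

Lemma minimal_sharp p : triple p p p = p ->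
  (forall x, triple p p x = x -> exists c, x = c *: p) -> sharp p = 0.
Proof.
rewrite triple_self => pp pmin.
have scal z : exists c, cross (sharp p) z = c *: p.
  have [|c e] := pmin (quad p z).
    (* Since U_p (star p) = p, [quad_shift] gives {p, p, U_p z} = U_p z, and minimality applies. *)
    rewrite /triple quad_shift pp; have := triple_self p (star z).
    by rewrite /triple starK => ->.
  exists (tform p z - c); rewrite scalerBl -e quad.unlock.
  by rewrite opprB addrCA subrr addr0.
have [N0 | Nn0] := eqVneq (norm3 p) 0.
  apply: (@rank_one_cross _ p) => //.
  by rewrite sharp_sharp N0 scale0r.
(* If N(p) is nonzero, [sharp_cross_cross] puts the diagonal idempotent on the line of p. That
   idempotent is nonzero with zero adjoint, so p^# = 0 as well. *)
have [c e] := scal (cross p (idem ord0)).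
have e0 : idem ord0 =
    ((norm3 p)^-1 * (c - tform (sharp p) (idem ord0))) *: p.
  by rewrite -scalerA scalerBl -e sharp_cross_cross addrK scalerA mulVf ?scale1r.
have := congr1 (@sharp R J) e0; rewrite sharpZ sharp_idem => /esym/eqP.
rewrite scaler_eq0 expf_eq0 /= => /orP[/eqP d0|/eqP //].
have := tr_idem J ord0; rewrite e0 d0 scale0r -(scale0r one) trZ mul0r => /eqP.
by rewrite eq_sym oner_eq0.
Qed.

Lemma rank_one_form p : p != 0 -> sharp p = 0 -> triple p p p = p ->
  tform p (star p) = 1.
Proof.
move=> pn0 p0; rewrite triple_self quad.unlock p0.
rewrite -(scale0r one) crossZl scale0r subr0 => /eqP.
rewrite -subr_eq0 -[X in _ - X]scale1r -scalerBl scaler_eq0 (negPf pn0) orbF.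
by rewrite subr_eq0 => /eqP.
Qed.

(** Vanishing adjoints kill every term of the cubic expansion in which an element repeats; only abc
    T(p × q, r) survives. *)
Lemma norm3_rank_one_sum p q r a b c :
  sharp p = 0 -> sharp q = 0 -> sharp r = 0 ->
  norm3 (a *: p + b *: q + c *: r) = a * b * c * norm3 (p + q + r).
Proof.
move=> p0 q0 r0.
have t0 x : tform 0 x = 0 by rewrite -(scale0r p) tformZl mul0r.
rewrite !(norm3D, norm3Z, sharpD, sharpZ, p0, q0, r0, scaler0, addr0, add0r).
rewrite !(tformC _ 0) !t0 !(norm3_eq0 p0) !(norm3_eq0 q0) !(norm3_eq0 r0).
rewrite !cross_lin !tform_lin; ring.
Qed.

Lemma tform_triple v x y :
  tform (triple v v x) (star y) = tform x (star (triple v v y)).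
Proof.
have starN w : star (- w) = - star w by rewrite -scaleN1r starZ rmorphN1 scaleN1r.
rewrite /triple !(starD, starN, star_mul, starK) !tform_lin.
rewrite (mulC (mul v (star v)) x) (mulC v x) !tform_assoc (mulC (star v) v).
by rewrite (mulC (mul (star y) v)) (mulC (star y) v) (mulC (mul (star v) (star y))).
Qed.

Lemma tform_starC x y : tform x (star y) = (tform y (star x))^*.
Proof.
by rewrite /tform -tr_star star_mul starK mulC.
Qed.
(** The operator {v, v, .} is self-adjoint for the Hermitian form, and v, w are eigenvectors for 1
    and 0. *)
Lemma orthogonal_tform v w :
  triple v v v = v -> triple v v w = 0 -> tform v (star w) = 0.
Proof.
have star0 : star (0 : J) = 0 by rewrite -(scale0r one) starZ rmorph0 !scale0r.
move=> vv vw; rewrite -{1}vv tform_triple vw star0.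
by rewrite tformC -(scale0r one) tformZl mul0r.
Qed.

Lemma unitary_mul_star u : (forall x, triple u u x = x) -> mul u (star u) = one.
Proof.
move/(_ one); rewrite /triple (mulC _ one) mul1 mul1 (mulC u one) mul1.
by rewrite (mulC (star u)) addrK.
Qed.

Lemma unitary_tform u : (forall x, triple u u x = x) -> tform u (star u) = 3.
Proof. by move/unitary_mul_star=> e; rewrite /tform e tr1. Qed.

(** For each summand s, orthogonality of u - s and s gives <u, s> = <s, s> = 1. As <u, u> = 3, the
    squared length of p + q + r - u is 3 - 6 + 3 = 0. *)
Lemma frame_sum u p q r : (forall x, triple u u x = x) ->
  [/\ triple p p p = p, triple q q q = q & triple r r r = r] ->
  [/\ tform p (star p) = 1, tform q (star q) = 1 & tform r (star r) = 1] ->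
  [/\ triple p p q = 0, triple p p r = 0 & triple q q r = 0] ->
  (forall s, s \in [:: p; q; r] -> triple (u - s) (u - s) (u - s) = u - s /\
    triple (u - s) (u - s) s = 0) ->
  p + q + r = u.
Proof.
move=> uu [p3 q3 r3] [p1 q1 r1] [pq pr qr] le.
have starN w : star (- w) = - star w by rewrite -scaleN1r starZ rmorphN1 scaleN1r.
have us s : s \in [:: p; q; r] -> tform u (star s) = tform s (star s).
  move=> /le [ut /(orthogonal_tform ut)].
  by rewrite tformDl tformNl => /eqP; rewrite subr_eq0 => /eqP.
have up := us p; have uq := us q; have ur := us r.
rewrite !inE !eqxx ?orbT p1 q1 r1 in up uq ur.
have {}up := up isT; have {}uq := uq isT; have {}ur := ur isT.
apply/eqP; rewrite -subr_eq0; apply/eqP/tform_star_eq0.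
rewrite !(starD, starN, tform_lin) (tform_starC p u) (tform_starC q u) (tform_starC r u).
rewrite (tform_starC q p) (tform_starC r p) (tform_starC r q).
rewrite up uq ur p1 q1 r1 (unitary_tform uu) (orthogonal_tform p3 pq).
rewrite (orthogonal_tform p3 pr) (orthogonal_tform q3 qr) rmorph1 rmorph0.
by ring.
Qed.

End Triple.

(** * Rank-one projections and frames *)

Section Frames.
Variables (R : realType) (J : cubic_jordan R).
Notation K := (complex R).
Implicit Types (u v w x y z p q r e : J) (c : K).

Definition rank_one_proj p := [/\ sharp p = 0, star p = p & tr p = 1].

Definition frame p q r :=
  [/\ rank_one_proj p, rank_one_proj q, rank_one_proj r & p + q + r = one].

Lemma rank_one_proj_tform p : rank_one_proj p -> tform p p = 1.
Proof.
move=> [p0 _ p1]; have := tr_sharp p; rewrite p0 p1 -(scale0r one) trZ mul0r.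
move/esym/eqP; rewrite mulf_eq0 invr_eq0 pnatr_eq0 /= mulr1 subr_eq0.
by move/eqP.
Qed.

Lemma rank_one_proj_mul p : rank_one_proj p -> mul p p = p.
Proof.
move=> pp; have [p0 _ p1] := pp; move: p0; rewrite sharp.unlock p1.
rewrite (rank_one_proj_tform pp) mulr1 subrr mulr0 scale0r addr0 scale1r.
by move/eqP; rewrite subr_eq0 => /eqP.
Qed.

Lemma triple_idempotent e x : mul e e = e -> star e = e -> triple e e x = mul e x.
Proof. by move=> ee es; rewrite /triple es ee (mulC x e) addrK. Qed.

Lemma mul_oppl x y : mul (- x) y = - mul x y.
Proof. by rewrite -scaleN1r mulZl scaleN1r. Qed.

Lemma mul_oppr x y : mul y (- x) = - mul y x.
Proof. by rewrite mulC mul_oppl mulC. Qed.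

Lemma sharpN x : sharp (- x) = sharp x.
Proof. by rewrite -scaleN1r sharpZ sqrrN expr1n scale1r. Qed.

Lemma trN x : tr (- x) = - tr x.
Proof. by rewrite -scaleN1r trZ mulN1r. Qed.

Lemma tr0 : tr (0 : J) = 0.
Proof. by rewrite -(scale0r one) trZ mul0r. Qed.

Lemma starN x : star (- x) = - star x.
Proof. by rewrite -scaleN1r starZ rmorphN1 scaleN1r. Qed.

Lemma star1 : star (one : J) = one.
Proof.
have e x : mul (star one) x = x by rewrite -[x]starK -star_mul mul1.
by rewrite -[LHS]mul1 mulC e.
Qed.

Lemma rank_one_proj_compl p : rank_one_proj p ->
  mul (one - p) (one - p) = one - p /\ star (one - p) = one - p.
Proof.
move=> pp; have [_ ps _] := pp; rewrite starD starN star1 ps; split=> //.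
rewrite mulDl !mulDr !mul_oppl !mul_oppr (rank_one_proj_mul pp) opprK.
by rewrite (mulC p) !mul1 addNr addr0.
Qed.

Lemma rank_one_proj_triple p : rank_one_proj p -> triple p p p = p.
Proof.
move=> pp; have [_ ps _] := pp.
by rewrite (triple_idempotent _ (rank_one_proj_mul pp) ps) rank_one_proj_mul.
Qed.

(** When p^# = 0 the operator U_p is T(p, .) p, and it fixes every x with p ∘ x = x. *)
Lemma rank_one_proj_minimal p x : rank_one_proj p ->
  triple p p x = x -> x = tform p x *: p.
Proof.
move=> pp; have [p0 ps _] := pp.
rewrite (triple_idempotent _ (rank_one_proj_mul pp) ps) => px.
have := triple_self p (star x); rewrite quad.unlock p0 starK.
rewrite /triple starK px (rank_one_proj_mul pp) (mulC x) px addrK => {1}->.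
by rewrite -(scale0r one) crossZl scale0r subr0.
Qed.

Lemma rank_one_proj_le p : rank_one_proj p ->
  triple (one - p) (one - p) (one - p) = one - p /\
  triple (one - p) (one - p) p = 0.
Proof.
move=> pp; have [e2 es] := rank_one_proj_compl pp.
rewrite !(triple_idempotent _ e2 es) e2; split=> //.
by rewrite mulDl mul1 mul_oppl (rank_one_proj_mul pp) subrr.
Qed.

Lemma frame_swap p q r : frame p q r -> frame q p r.
Proof. by case=> fp fq fr f; split; rewrite // (addrC q). Qed.

Lemma frame_rot p q r : frame p q r -> frame q r p.
Proof. by case=> fp fq fr f; split; rewrite // addrC addrA. Qed.

(** Since p × p = 0 and 1 × p = 1 - p, crossing the relation p + q + r = 1 with p, q and r gives
    three linear equations for the mixed products; solving them yields orthogonality in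
    [frame_mul]. *)
Lemma frame_cross p q r : frame p q r -> cross p q = r.
Proof.
case=> -[p0 _ p1] [q0 _ q1] [r0 _ r1] f.
have c1 x : cross one x = tr x *: one - x by exact: cross1.
have xx x : sharp x = 0 -> cross x x = 0 by move=> x0; rewrite cross_self x0 scaler0.
have := (c1 p, c1 q, c1 r); rewrite -f !crossDl !xx // p1 q1 r1 !scale1r.
rewrite (crossC q p) (crossC r p) (crossC r q) !(add0r, addr0) => -[[ep eq] er].
apply: (@scalerI K _ 2); rewrite ?pnatr_eq0 // !scaler_nat !mulr2n.
have -> : cross p q + cross p q = (cross p q + cross p r) + (cross p q + cross q r)
   - (cross p r + cross q r).
  apply: tform_inj => z; rewrite !tform_lin; ring.
rewrite ep eq er; apply: tform_inj => z; rewrite !tform_lin; ring.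
Qed.

Lemma frame_mul p q r : frame p q r -> mul p q = 0.
Proof.
move=> f; have pq := frame_cross f; have [[_ _ p1] [_ _ q1] [_ _ r1] f1] := f.
have t0 : tform p q = 0.
  have := tr_cross p q; rewrite pq p1 q1 r1 mulr1 => /eqP.
  by rewrite -subr_eq0 opprB addrC subrK => /eqP.
rewrite mulE pq p1 q1 t0 mulr1 subr0 !scale1r -f1 -(scaler0 _ 2^-1).
by congr (_ *: _); apply: tform_inj => z; rewrite tform0 !tform_lin; ring.
Qed.

Lemma frame_orthogonal p q r : frame p q r -> triple p p q = 0.
Proof.
move=> f; have [pp _ _ _] := f; have [_ ps _] := pp.
by rewrite (triple_idempotent _ (rank_one_proj_mul pp) ps) (frame_mul f).
Qed.

Lemma frame_sharp p q r (a b c : K) : frame p q r ->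
  sharp (a *: p + b *: q + c *: r) = (b * c) *: p + (a * c) *: q + (a * b) *: r.
Proof.
move=> f; have pq := frame_cross f; have qr := frame_cross (frame_rot f).
have pr := frame_cross (frame_rot (frame_rot f)).
have [[p0 _ _] [q0 _ _] [r0 _ _] _] := f.
rewrite !(sharpD, sharpZ) p0 q0 r0 !scaler0 !(addr0, add0r) !cross_lin pq qr.
rewrite (crossC p r) pr !scalerA; apply: tform_inj => z; rewrite !tform_lin; ring.
Qed.

Lemma frame_norm3 p q r (a b c : K) : frame p q r ->
  norm3 (a *: p + b *: q + c *: r) = a * b * c.
Proof.
move=> [[p0 _ _] [q0 _ _] [r0 _ _] f].
by rewrite (norm3_rank_one_sum _ _ _ p0 q0 r0) f norm31 mulr1.
Qed.

End Frames.

(** * Spectral decompositions *)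

Section SelfAdjoint.
Variables (R : realType) (J : cubic_jordan R).
Notation K := (complex R).
Implicit Types (u v w x y z p q r e : J) (c : K).

Lemma conj_fixed_real (c : K) : c^* = c -> exists a : R, c = real_complex R a.
Proof.
case: c => a b /eqP; rewrite eq_complex /= => /andP[_].
rewrite eq_sym -addr_eq0 -mulr2n mulrn_eq0 /= => /eqP->.
by exists a.
Qed.

Lemma conj_real (a : R) : (real_complex R a)^* = real_complex R a.
Proof. exact: conjc_real. Qed.

Lemma conj_half : (2^-1 : K)^* = 2^-1.
Proof. by rewrite rmorphV ?unitfE ?pnatr_eq0 // rmorph_nat. Qed.

Lemma tform_star x y : tform (star x) (star y) = (tform x y)^*.
Proof. by rewrite /tform -star_mul tr_star. Qed.

Lemma star_sharp x : star (sharp x) = sharp (star x).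
Proof.
rewrite !sharp.unlock !(starD, starN, starZ) star_mul star1 !tr_star tform_star.
by rewrite rmorphM /= conj_half rmorphB rmorphM.
Qed.

Lemma star_cross x y : star (cross x y) = cross (star x) (star y).
Proof.
rewrite !cross.unlock !(starD, starN, starZ) star_mul star1 !tr_star tform_star.
by rewrite rmorph_nat rmorphB rmorphM.
Qed.

Lemma norm3_star x : norm3 (star x) = (norm3 x)^*.
Proof.
rewrite !norm3.unlock -star_sharp tform_star rmorphM.
by rewrite rmorphV ?unitfE ?pnatr_eq0 // rmorph_nat.
Qed.

Lemma cubic_real_root (n s t : R) : exists a : R, n - a * s + a ^+ 2 * t - a ^+ 3 = 0.
Proof.
pose P : {poly R} := n%:P - s *: 'X + t *: 'X^2 - 'X^3.
have PE a : P.[a] = n - a * s + a ^+ 2 * t - a ^+ 3.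
  by rewrite !(hornerD, hornerN, hornerZ, hornerX, hornerXn, hornerC); ring.
(* A Cauchy bound: at points of modulus [M] the cube dominates the lower terms, so the polynomial
   changes sign on [-M, M]. *)
pose M := 1 + `|n| + `|s| + `|t|.
have n0 : 0 <= `|n| by []. have s0 : 0 <= `|s| by []. have t0 : 0 <= `|t| by [].
have M1 : 1 <= M by rewrite /M; lra.
have key (m : R) : `|m| = M -> `|n - m * s + m ^+ 2 * t| <= M ^+ 3.
  move=> mM; apply: (@le_trans _ _ (M ^+ 2 * (`|n| + `|s| + `|t|))); last first.
    rewrite [M ^+ 3]exprSr; apply: ler_wpM2l; first by rewrite exprn_ge0 //; lra.
    by rewrite /M; lra.
  apply: le_trans (ler_normD _ _) _; apply: le_trans (lerD (ler_normB _ _) (lexx _)) _.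
  rewrite (normrM m) (normrM (m ^+ 2)) normrX mM.
  have M2 : M <= M ^+ 2 by rewrite expr2 ler_peMr //; lra.
  have M3 : 1 <= M ^+ 2 by lra.
  rewrite !mulrDr lerD2r lerD //.
    by rewrite ler_peMl.
  by rewrite ler_wpM2r.
have MM : - M <= M by lra.
have [|a _ /rootP Pa] := @poly_ivt _ (- P) (- M) M MM.
  apply/andP; rewrite !hornerN !PE.
  have := key (- M); rewrite normrN ger0_norm; last lra.
  have := key M; rewrite ger0_norm; last lra.
  move=> /(_ erefl); rewrite ler_norml => /andP[_ h1].
  move=> /(_ erefl); rewrite ler_norml => /andP[h2 _].
  have e : (- M) ^+ 3 = - (M ^+ 3) by rewrite exprNn; ring.
  by rewrite e; split; lra.
by exists a; rewrite -PE; apply/eqP; rewrite -oppr_eq0 -hornerN Pa.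
Qed.

Lemma norm3_shift x (a : K) :
  norm3 (x - a *: one) = norm3 x - a * tr (sharp x) + a ^+ 2 * tr x - a ^+ 3.
Proof.
rewrite -scaleNr norm3D norm3Z sharpZ sharp1 norm31 !tform_lin !tformr1; ring.
Qed.

(** The characteristic polynomial of a self-adjoint element has real coefficients, and a real cubic
    has a real root. *)
Lemma self_adjoint_eigenvalue x : star x = x ->
  exists a : R, norm3 (x - real_complex R a *: one) = 0.
Proof.
move=> xs.
have [n en] : exists n, norm3 x = real_complex R n.
  by apply: conj_fixed_real; rewrite -norm3_star xs.
have [s es] : exists s, tr (sharp x) = real_complex R s.
  by apply: conj_fixed_real; rewrite -tr_star star_sharp xs.
have [t et] : exists t, tr x = real_complex R t.
  by apply: conj_fixed_real; rewrite -tr_star xs.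
have [a e] := cubic_real_root n s t; exists a; rewrite norm3_shift en es et.
by rewrite -!rmorphXn -!rmorphM -!(rmorphB, rmorphD) /= e rmorph0.
Qed.

(** When q^# = 0, [tr_sharp] gives T(q, q) = T(q)^2, so positivity makes the trace of q nonzero. *)
Lemma rank_one_normalize q : star q = q -> sharp q = 0 -> q != 0 ->
  exists2 t : R, t != 0 & tr q = real_complex R t /\
    rank_one_proj ((real_complex R t)^-1 *: q).
Proof.
move=> qs q0 qn0.
have [t et] : exists t, tr q = real_complex R t.
  by apply: conj_fixed_real; rewrite -tr_star qs.
have tn0 : real_complex R t != 0.
  apply/eqP => t0; case/eqP: qn0; apply: tform_star_eq0; rewrite qs.
  have := tr_sharp q; rewrite q0 et t0 mulr0 sub0r -(scale0r one) trZ mul0r.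
  by move/esym/eqP; rewrite mulf_eq0 invr_eq0 pnatr_eq0 oppr_eq0 => /eqP.
exists t; first by apply: contra_neq tn0 => ->.
split=> //; split; first by rewrite sharpZ q0 scaler0.
  by rewrite starZ qs fmorphV /= conj_real.
by rewrite trZ et mulVf.
Qed.

Lemma mul_one_r x : mul x one = x. Proof. by rewrite mulC mul1. Qed.

Lemma self_adjoint_eigenproj x : star x = x ->
  exists (a : R) p, rank_one_proj p /\ mul p (x - real_complex R a *: p) = 0.
Proof.
move=> xs; have [a] := self_adjoint_eigenvalue xs.
pose y := x - real_complex R a *: one.
rewrite -/y => y0.
have ys : star y = y by rewrite starD starN starZ star1 xs conj_real.
have xE : x = y + real_complex R a *: one by rewrite subrK.
clearbody y.
(* Triple eigenvalue: x is scalar and any rank-one projection serves. *)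
have [yz | yn0] := eqVneq y 0.
  have pp : rank_one_proj (idem ord0 : J).
    by split; rewrite ?sharp_idem ?star_idem ?tr_idem.
  exists a, (idem ord0); split=> //.
  by rewrite xE yz add0r mulDr mul_oppr !mulZr mul_one_r idem2 subrr.
(* Double eigenvalue [a]: here y itself has rank one, and its normalization belongs to the other
   eigenvalue a + t. *)
have [ysh0 | ysh] := eqVneq (sharp y) 0.
  have [t tn0 [et pp]] := rank_one_normalize ys ysh0 yn0.
  exists (a + t); eexists; split; first exact: pp.
  set p := _ *: y in pp *.
  have -> : x = real_complex R t *: p + real_complex R a *: one.
    by rewrite /p scalerA divff ?scale1r // fmorph_eq0.
  clearbody p.
  rewrite !(mulDr, mul_oppr, mulZr) mul_one_r (rank_one_proj_mul pp) rmorphD /=.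
  by apply: tform_inj => z; rewrite tform0 !tform_lin; ring.
(* Otherwise y^# has rank one, because y^## = N(y) y = 0, and [mul_sharp] makes it annihilate y. *)
have qs : star (sharp y) = sharp y by rewrite star_sharp ys.
have q0 : sharp (sharp y) = 0 by rewrite sharp_sharp y0 scale0r.
have [t tn0 [et pp]] := rank_one_normalize qs q0 ysh.
exists a; eexists; split; first exact: pp.
set p := _ *: _ in pp *.
have py : mul p y = 0 by rewrite /p mulZl mulC mul_sharp y0 scale0r scaler0.
clearbody p.
by rewrite xE !(mulDr, mul_oppr, mulZr) py mul_one_r (rank_one_proj_mul pp) add0r subrr.
Qed.

Lemma compl_cross p x : rank_one_proj p -> mul p x = 0 -> tr x = 0 ->
  cross p x = - x.
Proof.
move=> pp px tx; have [_ _ p1] := pp.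
have t0 : tform p x = 0 by rewrite /tform px -(scale0r one) trZ mul0r.
rewrite cross.unlock px p1 tx t0 mulr0 subr0 !scale0r scaler0 scale1r.
by rewrite sub0r subr0 addr0.
Qed.

Lemma compl_sharp p : rank_one_proj p -> sharp (one - p) = p.
Proof.
move=> [p0 _ p1].
rewrite sharpD sharp1 crossNr cross1 p1 scale1r sharpN p0 addr0.
by apply: tform_inj => z; rewrite !tform_lin; ring.
Qed.

(** On traceless elements annihilated by p, the operator p × acts as -1; [sharp_cross] then makes
    x^# a multiple of p, and the trace gives the coefficient. This is the quadratic form of the spin
    factor complementary to p. *)
Lemma compl_sharp_orth p x : rank_one_proj p -> mul p x = 0 -> tr x = 0 ->
  sharp x = (- 2^-1 * tform x x) *: p.
Proof.
move=> pp px tx; have [p0 _ p1] := pp.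
have c0 : cross 0 (sharp x) = 0 :> J.
  by rewrite -(scale0r p) crossZl !scale0r.
have e : sharp x = tform p (sharp x) *: p.
  have := sharp_cross p x; rewrite (compl_cross pp px tx) p0 tform0 scale0r c0.
  by rewrite sharpN subr0 add0r.
rewrite {1}e; congr (_ *: _).
have := congr1 tr e; rewrite trZ p1 mulr1 => <-.
by rewrite tr_sharp tx mul0r sub0r; ring.
Qed.

(** The normalization T(w, w) = 2 amounts to w^2 = 1 - p, so the last two elements are the spectral
    projections of w in the spin factor. *)
Lemma compl_frame p w : rank_one_proj p -> star w = w -> mul p w = 0 -> tr w = 0 ->
  tform w w = 2 ->
  frame p (2^-1 *: (one - p + w)) (2^-1 *: (one - p - w)).
Proof.
move=> pp ws pw tw ww; have [_ ps p1] := pp.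
have half c : (-1) ^+ 2 = 1 :> K by rewrite sqrrN expr1n.
have ew : cross (one - p) w = 0.
  rewrite crossDl crossNl cross1 tw scale0r sub0r (compl_cross pp pw tw) opprK.
  by rewrite addNr.
have wsh : sharp w = - p.
  by rewrite (compl_sharp_orth pp pw tw) ww -scaleN1r; congr (_ *: _); field.
have proj (b : bool) : rank_one_proj (2^-1 *: (one - p + (-1) ^+ b *: w)).
  split.
  - rewrite sharpZ sharpD (compl_sharp pp) crossZr ew scaler0 addr0 sharpZ.
    by rewrite -exprM mulnC exprM sqrrN !expr1n scale1r wsh subrr scaler0.
  - rewrite starZ conj_half !starD starN star1 ps starZ ws.
    by congr (_ *: (_ + _ *: _)); case: b; rewrite ?rmorphN1 ?rmorph1.
  by rewrite trZ !trD trZ tw mulr0 addr0 trN tr1 p1; field.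
split=> //.
- by have := proj false; rewrite scale1r.
- by have := proj true; rewrite scaleN1r.
by apply: tform_inj => y; rewrite !tform_lin; field.
Qed.

(* Some [cross p (idem i)] is not a multiple of [one - p]; remove its trace. *)
Lemma compl_nonzero p : rank_one_proj p ->
  exists w, [/\ star w = w, mul p w = 0, tr w = 0 & w != 0].
Proof.
move=> pp; have [p0 ps p1] := pp.
have [i hi] : exists i, ~ exists c, cross p (idem i) = c *: (one - p).
  apply: contrapT => /forallNP h.
  have p_eq0 : p = 0.
    apply: (rank_one_cross p0 (compl_sharp pp)) => i.
    by apply: contrapT; apply: h.
  by move: p1; rewrite p_eq0 -(scale0r one) trZ mul0r => /eqP; rewrite eq_sym oner_eq0.
pose r : J := idem i; pose v := cross p r.
have tv : tr v = tform (one - p) r by rewrite tr_cross p1 mul1r tformDl tformNl tform1.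
have nE : norm3 (one - p) = 0.
  rewrite norm3.unlock compl_sharp // tformDl tformNl tform1 p1.
  by rewrite rank_one_proj_tform // subrr mulr0.
(* Apply [cross_cross_sharp] to 1 - p, whose adjoint is p and whose norm is 0. *)
have pv : cross p v = tr v *: one - v - tr v *: p.
  have := cross_cross_sharp (one - p) r; rewrite compl_sharp // nE scale0r add0r.
  rewrite -/v crossDl crossNl cross1 tv => /eqP; rewrite subr_eq => /eqP ->.
  by rewrite addrC addKr.
have tpv : tform p v = 0.
  by rewrite tformC /v crossC tform_crossA cross_self p0 scaler0 tformC tform0.
have mpv : mul p v = 0.
  rewrite mulE pv p1 tpv mul1r; apply: tform_inj => z; rewrite tform0 !tform_lin; ring.
have vs : star v = v.
  by rewrite /v star_cross ps star_idem.
exists (v - (2^-1 * tr v) *: (one - p)); split.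
- rewrite starD starN starZ vs; have [_ ->] := rank_one_proj_compl pp.
  by rewrite rmorphM /= conj_half -tr_star vs.
- rewrite mulDr mul_oppr mulZr mpv mulDr mul_oppr mul_one_r rank_one_proj_mul //.
  by rewrite subrr scaler0 subr0.
- by rewrite trD trN trZ trD trN tr1 p1; field.
apply/eqP => /eqP; rewrite subr_eq0 => /eqP vE.
by apply: hi; eexists; exact: vE.
Qed.

Lemma self_adjoint_spectral x : star x = x -> exists (a b c : R) p q r,
  frame p q r /\ x = real_complex R a *: p + real_complex R b *: q
    + real_complex R c *: r.
Proof.
move=> xs; have [a [p [pp]]] := self_adjoint_eigenproj xs.
set z := x - _ => pz; have [p0 ps p1] := pp.
have zs : star z = z by rewrite starD starN starZ ps xs conj_real.
have [t et] : exists t, tr z = real_complex R t.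
  by apply: conj_fixed_real; rewrite -tr_star zs.
have [e2 es] := rank_one_proj_compl pp.
have pe : mul p (one - p) = 0.
  by rewrite mulDr mul_oppr mul_one_r rank_one_proj_mul // subrr.
(* The complement 1 - p has trace 2, so this removes the trace of z. *)
pose w := z - real_complex R (t / 2) *: (one - p).
have ws : star w = w by rewrite starD starN starZ zs es conj_real.
have pw : mul p w = 0 by rewrite mulDr mul_oppr mulZr pz pe scaler0 subr0.
have tw : tr w = 0.
  rewrite trD trN trZ trD trN tr1 p1 et rmorphM fmorphV rmorph_nat.
  by field.
have norm (v : J) : star v = v -> mul p v = 0 -> tr v = 0 -> v != 0 ->
    exists d : R, exists w1 : J, [/\ v = real_complex R d *: w1, star w1 = w1,
      mul p w1 = 0, tr w1 = 0 & tform w1 w1 = 2].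
  move=> vs pv tv vn0.
  have vv : 0 <= tform v v by rewrite -{2}vs tform_star_ge0.
  have vvn0 : tform v v != 0.
    by apply: contra_neq vn0 => vv0; apply: tform_star_eq0; rewrite vs.
  have [d ed] : exists d, tform v v = real_complex R d.
    by apply: conj_fixed_real; rewrite -tform_star vs.
  have d0 : 0 < d by move: vv vvn0; rewrite ed lecR fmorph_eq0 lt0r => -> ->.
  pose f := Num.sqrt (d / 2); have f0 : f != 0 by rewrite sqrtr_eq0 -ltNge divr_gt0.
  have f2 : f ^+ 2 = d / 2 by rewrite sqr_sqrtr // divr_ge0 // ltW.
  have fn0 : real_complex R f != 0 by rewrite fmorph_eq0.
  exists f, ((real_complex R f)^-1 *: v); split.
  - by rewrite scalerA divff // scale1r.
  - by rewrite starZ vs fmorphV /= conj_real.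
  - by rewrite mulZr pv scaler0.
  - by rewrite trZ tv mulr0.
  rewrite !tform_lin mulrA -expr2 exprVn -rmorphXn f2 ed rmorphM fmorphV rmorph_nat.
  by field; rewrite fmorph_eq0 gt_eqF.
have [d [w1 [wd w1s pw1 tw1 ww1]]] : exists d : R, exists w1 : J,
    [/\ w = real_complex R d *: w1, star w1 = w1,
      mul p w1 = 0, tr w1 = 0 & tform w1 w1 = 2].
  (* If w vanishes, any normalized traceless direction of the complement gives a frame, with d =
     0. *)
  have [w0 | wn0] := eqVneq w 0; last exact: norm.
  have [v [vs pv tv vn0]] := compl_nonzero pp.
  have [d [w1 [_ w1s pw1 tw1 ww1]]] := norm v vs pv tv vn0.
  by exists 0, w1; split; rewrite // w0 scale0r.
have f := compl_frame pp w1s pw1 tw1 ww1.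
exists a, (t / 2 + d), (t / 2 - d), p; do 2! eexists; split; first exact: f.
have -> : x = real_complex R a *: p + (real_complex R (t / 2) *: (one - p) + w).
  by rewrite /w subrKC /z subrKC.
rewrite wd rmorphD rmorphB /=; apply: tform_inj => y; rewrite !tform_lin; by field.
Qed.

End SelfAdjoint.

(** * The U-operators, unitaries and the Cayley transform *)

Section Unitary.
Variables (R : realType) (J : cubic_jordan R).
Notation K := (complex R).
Implicit Types (u v w x y z p q r e : J) (c : K).

Lemma quadE x y : quad x y = tform x y *: x - cross (sharp x) y.
Proof. by rewrite quad.unlock. Qed.

Lemma quadDr x y z : quad x (y + z) = quad x y + quad x z.
Proof.
rewrite !quadE; apply: tform_inj => w.
by rewrite !(tform_lin, cross_lin); ring.
Qed.

Lemma quadZr c x y : quad x (c *: y) = c *: quad x y.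
Proof.
rewrite !quadE; apply: tform_inj => w.
by rewrite !(tform_lin, cross_lin); ring.
Qed.

Lemma quadNr x y : quad x (- y) = - quad x y.
Proof. by rewrite -scaleN1r quadZr scaleN1r. Qed.

Lemma quadZl c x y : quad (c *: x) y = c ^+ 2 *: quad x y.
Proof.
rewrite !quadE sharpZ; apply: tform_inj => w.
by rewrite !(tform_lin, cross_lin); ring.
Qed.

Lemma tform_quad x y z : tform (quad x y) z = tform y (quad x z).
Proof.
rewrite !quadE !tform_lin (tformC y x) (tformC y (cross _ _)).
by rewrite !tform_crossA (crossC y z); ring.
Qed.

Lemma sharp_quad x y : sharp (quad x y) = quad (sharp x) (sharp y).
Proof.
rewrite !quadE sharpD sharpN sharpZ crossNr crossZl cross_cross_sharp sharp_cross.
rewrite sharp_sharp; apply: tform_inj => w; rewrite !(tform_lin, cross_lin); ring.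
Qed.

Lemma quad_cross x y z : cross (quad x y) (quad x z) = quad (sharp x) (cross y z).
Proof.
have := sharp_quad x (y + z); rewrite quadDr !sharpD !quadDr !sharp_quad.
by move/addIr/addrI.
Qed.

(** The dual of [quad_cross], since U_x is self-adjoint for the trace form. *)
Lemma quad_cross_quad x y z :
  quad x (cross y (quad x z)) = cross (quad (sharp x) y) z.
Proof.
apply: tform_inj => w.
by rewrite tform_quad !tform_crossA quad_cross -tform_quad.
Qed.

(** Expand U_y into its two terms: [tform_quad] moves the scalar one, [quad_cross_quad] and
    [sharp_quad] the other. *)
Lemma quad_fundamental x y z : quad (quad x y) z = quad x (quad y (quad x z)).
Proof.
rewrite (quadE y) quadDr quadNr quadZr.
by rewrite quad_cross_quad quadE sharp_quad tform_quad.
Qed.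

(** As x^# = N(x) x^(-1) for invertible x, this is U_x U_(x^(-1)) = 1 cleared of denominators. *)
Lemma quad_sharp x y : quad x (quad (sharp x) y) = norm3 x ^+ 2 *: y.
Proof.
have e1 : quad x (sharp x) = norm3 x *: x.
  rewrite quadE tform_norm cross_self sharp_sharp.
  by apply: tform_inj => z; rewrite !tform_lin; ring.
have e2 : quad x (cross x y) = tform (sharp x) y *: x - norm3 x *: y.
  rewrite quadE sharp_cross_cross tformC tform_sharp.
  by apply: tform_inj => z; rewrite !tform_lin; ring.
rewrite (quadE (sharp x)) sharp_sharp crossZl quadDr quadZr e1 -scaleN1r quadZr.
by rewrite quadZr e2; apply: tform_inj => z; rewrite !tform_lin; ring.
Qed.

Lemma quad1 y : quad one y = y.
Proof.
rewrite quadE sharp1 cross1 tform1; apply: tform_inj => z; rewrite !tform_lin; ring.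
Qed.

Lemma quad_one x : quad x one = mul x x.
Proof.
rewrite quadE crossC cross1 tformr1 tr_sharp sharp.unlock.
by apply: tform_inj => z; rewrite !tform_lin; ring.
Qed.

Lemma star_quad x y : star (quad x y) = quad (star x) (star y).
Proof.
by rewrite !quadE starD starN starZ star_cross star_sharp tform_star.
Qed.

(** This says that star u is the inverse of u. The identity {u, u, x} = x makes multiplication by u
    and by star u commute; on u^#, one order gives N(u) star u by Cayley-Hamilton and the other
    returns u^#. *)
Lemma unitary_sharp u : (forall x, triple u u x = x) ->
  sharp u = norm3 u *: star u.
Proof.
move=> uu; have u1 := unitary_mul_star uu.
have comm x : mul (mul x (star u)) u = mul (mul u x) (star u).
  have := uu x; rewrite /triple u1 mul1 -addrA => /eqP.
  by rewrite -subr_eq0 addrAC subrr add0r subr_eq0 => /eqP.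
have u2 : mul (mul u u) (star u) = u by rewrite -comm u1 mul1.
have := comm (sharp u); rewrite mul_sharp mulZl mul1 => <-.
have -> : mul (sharp u) (star u) = u - tr u *: one + tr (sharp u) *: star u.
  rewrite tr_sharp sharp.unlock !(mulDl, mul_oppl, mulZl) u2 u1 mul1 //.
rewrite !(mulDl, mul_oppl, mulZl) mul1 (mulC (star u)) u1.
by rewrite tr_sharp {1}sharp.unlock.
Qed.

(** If N(u) = 0 then u^# = 0, and u would have squared length 1 instead of 3. Otherwise compare
    N(u^#) = N(u)^2 with the norm of N(u) star u. *)
Lemma unitary_norm3 u : (forall x, triple u u x = x) ->
  norm3 u * (norm3 u)^* = 1.
Proof.
move=> uu; have us := unitary_sharp uu.
have N0 : norm3 u != 0.
  apply/eqP => N0; move: us; rewrite N0 scale0r => u0.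
  have un0 : u != 0.
    apply/eqP => uz; have := unitary_tform uu; rewrite uz tform0 => /eqP.
    by rewrite eq_sym pnatr_eq0.
  have := rank_one_form un0 u0 (uu u); rewrite unitary_tform // => /eqP.
  by rewrite (eqr_nat _ 3 1).
have := norm3_sharp u; rewrite {1}us norm3Z norm3_star => e.
apply: (mulfI (expf_neq0 2 N0)); rewrite mulr1 -[RHS]e; ring.
Qed.

Lemma cayley_spectral t (n := norm3 t) : sharp t = n *: star t -> n * n^* = 1 ->
  norm3 (one - t) != 0 ->
  exists (a b c : K) p q r, [/\ frame p q r, t = a *: p + b *: q + c *: r
    & [/\ `|a| = 1, `|b| = 1 & `|c| = 1]].
Proof.
move=> ts nn D0; pose T := tr t; pose D := norm3 (one - t).
have DE : D = 1 - T + n * T^* - n.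
  rewrite /D norm3D sharp1 norm31 sharpN ts !tform_lin !tform1 tr_star.
  by rewrite -scaleN1r norm3Z -/n -/T; ring.
have sE : sharp (one - t) = (1 - T) *: one + t + n *: star t.
  rewrite sharpD sharp1 sharpN ts crossNr cross1 -/T.
  by apply: tform_inj => z; rewrite !tform_lin; ring.
have n0 : n != 0.
  by apply/eqP => nz; move/eqP: nn; rewrite nz mul0r eq_sym oner_eq0.
have conjDE : D^* = - n^* * D.
  rewrite DE !(rmorphB, rmorphD, rmorphM, rmorph1) /= conjCK.
  rewrite (_ : - n^* * (1 - T + n * T^* - n)
    = - n^* + n^* * T - (n * n^*) * T^* + n * n^*); last by ring.
  by rewrite nn; ring.
pose Y := D^-1 *: sharp (one - t).
(* The scalar model is 1/(1 - t) + 1/(1 - conj t) = 1 on the unit circle. *)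
have YY : Y + star Y = one.
  rewrite /Y sE starZ !starD !starZ starK star1 fmorphV /= conjDE.
  rewrite !(rmorphB, rmorph1) /= -/T.
  have -> : (- n^* * D)^-1 = - n / D.
    rewrite invfM; congr (_ * _); apply: (mulfI (_ : - n^* != 0)).
      by rewrite oppr_eq0 fmorph_eq0.
    by rewrite mulfV ?oppr_eq0 ?fmorph_eq0 // mulrNN mulrC nn.
  apply: tform_inj => z; rewrite !tform_lin.
  have -> : n^* = n^-1 by apply: (mulfI n0); rewrite nn mulfV.
  have {}DE : T^* = (D - 1 + T + n) / n by rewrite DE; field.
  rewrite DE; by field; rewrite n0.
pose h := (2 * 'i) *: Y - 'i *: one.
(* h is the Cayley transform of t, since Y is the inverse of 1 - t. *)
have hs : star h = h.
  rewrite /h starD starN (starZ _ Y) (starZ _ one) star1 rmorphM rmorph_nat /= conjCi.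
  have -> : star Y = one - Y by rewrite -YY addrC addKr.
  by apply: tform_inj => z; rewrite !tform_lin; ring.
have [a [b [c [p [q [r [f hE]]]]]]] := self_adjoint_spectral hs.
have i0 : 'i != 0 :> K by exact: neq0Ci.
(* The eigenvalue of [Y] at an eigenvalue x of h, from h = 2iY - i; below, 1 - 1/B(x) = (x - i)/(x +
   i) has modulus 1. *)
pose B (x : R) : K := (real_complex R x + 'i) / (2 * 'i).
have B0 (d : R) : real_complex R d + 'i != 0.
  apply/eqP => /eqP; rewrite addr_eq0 => /eqP e.
  have := conj_real d; rewrite e rmorphN /= conjCi opprK => /eqP.
  by rewrite -subr_eq0 opprK -mulr2n mulrn_eq0 /= (negPf i0).
have YE : Y = B a *: p + B b *: q + B c *: r.
  have [_ _ _ f1] := f.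
  have -> : Y = (2 * 'i)^-1 *: (h + 'i *: one).
    by rewrite /h subrK scalerA mulVf ?scale1r // mulf_neq0 ?pnatr_eq0.
  rewrite hE -f1 /B; apply: tform_inj => z; rewrite !tform_lin; by field; rewrite i0.
have NY : norm3 Y = D^-1.
  rewrite /Y norm3Z norm3_sharp -/D; by field.
(* As N(Y) = 1/D, the element D Y^# is the inverse of [Y], namely 1 - t. *)
have tE : t = one - D *: sharp Y.
  rewrite /Y sharpZ sharp_sharp -/D !scalerA.
  have -> : D * D^-1 ^+ 2 * D = 1 by field.
  by rewrite scale1r opprB addrC subrK.
have DB : D^-1 = B a * B b * B c by rewrite -NY YE frame_norm3.
have BN0 (d : R) : B d != 0 by rewrite mulf_neq0 ?B0 // invr_eq0 mulf_neq0 ?pnatr_eq0.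
have Bnorm (x : R) : `|1 - (B x)^-1| = 1.
  have -> : 1 - (B x)^-1 = (real_complex R x - 'i) / (real_complex R x + 'i).
    rewrite /B; field; by rewrite B0 i0.
  have -> : real_complex R x - 'i = (real_complex R x + 'i)^*.
    by rewrite rmorphD /= conj_real conjCi.
  by rewrite normrM normfV norm_conjC mulfV // normr_eq0.
exists (1 - (B a)^-1), (1 - (B b)^-1), (1 - (B c)^-1), p, q, r; split=> //.
have [_ _ _ f1] := f.
rewrite {1}tE YE frame_sharp // -f1 -[D]invrK DB.
apply: tform_inj => z; rewrite !tform_lin; field; by rewrite !BN0.
Qed.

End Unitary.

(** * Spectral theorem for unitaries and transport from the unit to a unitary *)

Section Transport.
Variables (R : realType) (J : cubic_jordan R).
Notation K := (complex R).
Implicit Types (u v w x y z p q r e : J) (c : K).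

(* Summing the four equations leaves [4 = 0]. *)
Lemma cubic_fourth_roots (s t n : K) :
  ~ (forall d : K, d * d^* = 1 -> 1 - d * s + d ^+ 2 * t - d ^+ 3 * n = 0).
Proof.
move=> h; have ii : 'i * 'i = -1 :> K by rewrite -expr2 sqrCi.
have := (h 1, h (-1), h 'i, h (- 'i)) => -[[[h1 h2] h3] h4].
rewrite rmorph1 mulr1 in h1; rewrite rmorphN1 mulrNN mulr1 in h2.
rewrite conjCi mulrN ii opprK in h3.
rewrite rmorphN /= conjCi opprK mulNr ii opprK in h4.
have i3 : 'i ^+ 3 = - 'i :> K by rewrite exprS sqrCi mulrN1.
have i3N : (- 'i) ^+ 3 = 'i :> K by rewrite exprS sqrrN sqrCi mulrN1 opprK.
rewrite i3 sqrCi in h3; rewrite i3N sqrrN sqrCi in h4.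
have : 4%:R = 0 :> K.
  rewrite (_ : 4%:R = (1 - 1 * s + 1 ^+ 2 * t - 1 ^+ 3 * n)
    + (1 - -1 * s + (-1) ^+ 2 * t - (-1) ^+ 3 * n)
    + (1 - 'i * s + -1 * t - - 'i * n) + (1 - - 'i * s + -1 * t - 'i * n)); last by ring.
  by rewrite h1 // h2 // h3 // h4 // !addr0.
by move/eqP; rewrite pnatr_eq0.
Qed.

(** Rotating u by a suitable unit scalar w removes 1 from its spectrum, so the Cayley transform
    applies; w exists by [cubic_fourth_roots]. *)
Lemma unitary_spectral u : (forall x, triple u u x = x) ->
  exists (a b c : K) p q r, [/\ frame p q r, u = a *: p + b *: q + c *: r
    & [/\ `|a| = 1, `|b| = 1 & `|c| = 1]].
Proof.
move=> uu; have us := unitary_sharp uu; have nn := unitary_norm3 uu.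
have NE c : norm3 (one - c *: u) =
    1 - c * tr u + c ^+ 2 * tr (sharp u) - c ^+ 3 * norm3 u.
  by rewrite -scaleNr norm3D norm3Z sharpZ sharp1 norm31 !tform_lin !tform1; ring.
have [w [ww w0]] : exists w : K, w * w^* = 1 /\ norm3 (one - w *: u) != 0.
  apply: contrapT => /forallNP h.
  apply: (@cubic_fourth_roots (tr u) (tr (sharp u)) (norm3 u)).
  by move=> d dd; rewrite -NE; apply/eqP/negPn/negP => n0; apply: (h d).
have wn0 : w != 0 by apply/eqP => wz; move/eqP: ww; rewrite wz mul0r eq_sym oner_eq0.
pose t := w *: u.
have ts : sharp t = norm3 t *: star t.
  rewrite /t sharpZ us norm3Z starZ !scalerA; congr (_ *: _).
  rewrite (_ : w ^+ 3 * norm3 u * w^* = w ^+ 2 * norm3 u * (w * w^*)); last by ring.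
  by rewrite ww mulr1.
have tn : norm3 t * (norm3 t)^* = 1.
  rewrite /t norm3Z rmorphM rmorphXn /= mulrACA nn mulr1 -exprMn ww expr1n //.
have [a [b [c [p [q [r [f tE [a1 b1 c1]]]]]]]] := cayley_spectral ts tn w0.
have w1 : `|w| = 1.
  by apply/eqP; rewrite -(@pexpr_eq1 _ _ 2) // normCK ww.
exists (w^-1 * a), (w^-1 * b), (w^-1 * c), p, q, r; split=> //.
  have -> : u = w^-1 *: t by rewrite /t scalerA mulVf ?scale1r.
  by rewrite tE !scalerDr !scalerA.
by rewrite !normrM normfV w1 a1 b1 c1 invr1 mulr1.
Qed.

Lemma triple_polar x y z : 2 *: triple x y z =
  triple (x + z) y (x + z) - triple x y x - triple z y z.
Proof.
rewrite /triple !(mulDl, mulDr) (mulC z x).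
by apply: tform_inj => w; rewrite !tform_lin; ring.
Qed.

Lemma quad_star_inv v x : sharp v = norm3 v *: star v -> norm3 v * (norm3 v)^* = 1 ->
  quad v (quad (star v) x) = x.
Proof.
move=> vs nn; have n0 : norm3 v != 0.
  by apply/eqP => nz; move/eqP: nn; rewrite nz mul0r eq_sym oner_eq0.
have := quad_sharp v x; rewrite vs quadZl quadZr => e.
by apply: (scalerI (expf_neq0 2 n0)).
Qed.

(** With equal outer arguments this is the fundamental formula together with U_v U_(star v) = 1;
    polarisation gives the rest. *)
Lemma quad_triple v x y z : sharp v = norm3 v *: star v ->
  norm3 v * (norm3 v)^* = 1 ->
  quad v (triple x y z) = triple (quad v x) (quad v y) (quad v z).
Proof.
move=> vs nn.
have diag a b : quad v (triple a b a) = triple (quad v a) (quad v b) (quad v a).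
  by rewrite !triple_self quad_fundamental star_quad quad_star_inv.
apply: (@scalerI K _ 2); rewrite ?pnatr_eq0 // -quadZr !triple_polar.
rewrite -(quadDr v x z) -!diag.
move: (triple (x + z) y (x + z)) (triple x y x) (triple z y z) => A B C.
by rewrite !quadDr !quadNr.
Qed.

Lemma unitary_transport u : (forall x, triple u u x = x) ->
  exists T : {linear J -> J}, [/\ bijective T, T one = u
    & forall x y z, T (triple x y z) = triple (T x) (T y) (T z)].
Proof.
move=> /unitary_spectral [a [b [c [p [q [r [f uE [a1 b1 c1]]]]]]]].
(* A unitary square root of u: then U_v 1 = v^2 = u, and the inverse of U_v is U_(star v). *)
pose v := sqrtC a *: p + sqrtC b *: q + sqrtC c *: r.
have unit_sqrt (d : K) : `|d| = 1 -> sqrtC d * (sqrtC d)^* = 1.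
  move=> d1; rewrite -normCK -normrX sqrtCK //.
have [[_ ps _] [_ qs _] [_ rs _] _] := f.
have NE : norm3 v = sqrtC a * sqrtC b * sqrtC c by rewrite /v frame_norm3.
have [a2 b2 c2] := And3 (unit_sqrt a a1) (unit_sqrt b b1) (unit_sqrt c c1).
have vs : sharp v = norm3 v *: star v.
  rewrite NE /v frame_sharp // !starD !starZ ps qs rs.
  move: a2 b2 c2; set d := sqrtC a; set e := sqrtC b; set g := sqrtC c => a2 b2 c2.
  apply: tform_inj => z; rewrite !tform_lin.
  rewrite (_ : d * e * g * (d^* * tform p z + e^* * tform q z + g^* * tform r z) =
    (d * d^*) * (e * g * tform p z) + (e * e^*) * (d * g * tform q z)
    + (g * g^*) * (d * e * tform r z)); last by ring.
  by rewrite a2 b2 c2 !mul1r.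
have vn : norm3 v * (norm3 v)^* = 1.
  by rewrite NE !rmorphM /= mulrACA [X in X * _]mulrACA a2 b2 c2 !mulr1.
have inv2 x : quad (star v) (quad v x) = x.
  have vs' : sharp (star v) = norm3 (star v) *: star (star v).
    by rewrite -star_sharp vs starZ norm3_star.
  by rewrite -{2}[v]starK quad_star_inv // norm3_star conjCK mulrC.
have lin : linear (quad v) by move=> d x y; rewrite quadDr quadZr.
pose T : {linear J -> J} := HB.pack (quad v) (GRing.isLinear.Build _ _ _ _ _ lin).
exists T; split.
- by exists (quad (star v)) => x; [exact: inv2 | exact: quad_star_inv].
- rewrite /= quad_one uE /v.
  have [pp qq rr _] := f.
  have pq := frame_mul f; have qr := frame_mul (frame_rot f).
  have rp := frame_mul (frame_rot (frame_rot f)).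
  rewrite !(mulDl, mulDr, mulZl, mulZr) (mulC q p) (mulC r q) (mulC p r).
  rewrite pq qr rp !rank_one_proj_mul // !scaler0 !(addr0, add0r) !scalerA.
  by rewrite -!expr2 !sqrtCK.
by move=> x y z; rewrite /= quad_triple.
Qed.

(** Pulled back along T, the condition x = {u, x, u} becomes y = {1, y, 1}, which is
    self-adjointness. *)
Lemma unitary_reality u x (T : {linear J -> J}) : bijective T -> T one = u ->
  (forall x y z, T (triple x y z) = triple (T x) (T y) (T z)) ->
  x = triple u x u -> exists2 y, x = T y & star y = y.
Proof.
move=> [S TS ST] T1 Tt xu; exists (S x); rewrite ?ST //.
apply: (can_inj TS); rewrite ST {2}xu -T1 -{2}[x]ST -Tt triple_self quad1 //.
Qed.

End Transport.

(** * The determinant *)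

Section Instance.
Variable R : realType.
Notation K := (complex R).
Notation O := (octonion R).

Lemma oct_form0 (x : O) : oct_form 0 x = 0.
Proof. by rewrite -(scale0r x) oct_formZl mul0r. Qed.

Lemma oct_zero_combination (a b : K) :
  2^-1 *: (a *: 0 + b *: 0 + (cd_diam (cd_mul 0 0) + cd_diam (cd_mul 0 0)))
  = 0 :> O.
Proof.
rewrite cd_mul0r; have -> : cd_diam 0 = 0 :> O by exact: linear0.
by rewrite !scaler0 !addr0 scaler0.
Qed.

Lemma junit_mul i : jmul (junit R i) (junit R i) = junit R i.
Proof.
apply: C6_diagSE => j.
  by rewrite diagc_jmul !diagc_junit !offc_junit oct_form0 !addr0; case: eqP;
    rewrite ?mulr1 ?mulr0.
rewrite offc_jmul !offc_junit; exact: oct_zero_combination.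
Qed.

Lemma junit_sum :
  junit R ord0 + junit R (ordS ord0) + junit R (ordS (ordS ord0)) = jone.
Proof.
apply: C6_diagSE => j.
  rewrite !diagcD !diagc_junit diagc_jone.
  by case: j => [[|[|[|]]] ?] //=; rewrite ?addr0 ?add0r.
by rewrite !offcD !offc_junit offc_jone !addr0.
Qed.

Lemma junit_star i : jstar (junit R i) = junit R i.
Proof.
apply: C6_diagSE => j; first by rewrite diagc_jstar diagc_junit conjC_nat.
by rewrite offc_jstar offc_junit cd_bar0.
Qed.

Lemma junit_tr i : jtr (junit R i) = 1.
Proof.
rewrite (jtrE i) !diagc_junit eqxx.
by case: i => [[|[|[|]]] ?] //=; rewrite !addr0.
Qed.

Definition C6_cubic : cubic_jordan R :=
  @CubicJordan R (C6 R) (@jmul R) jone (@jtr R) (@jstar R) (junit R)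
    (@jmulC R) (@jmulDl R) (@jmulZl R) (@jmul1 R) (@jtrD R) (@jtrZ R) (@jtr1 R)
    (@jform_assoc R) (@jsharp_sharp R) (@jstarD R) (@jstarZ R) (@jstarK R)
    (@jstar_jmul R) (@jtr_jstar R) (@jform_star_ge0 R) (@jform_star_eq0 R)
    junit_sum junit_mul junit_star junit_tr.

End Instance.

Section Determinant.
Variable R : realType.
Notation K := (complex R).
Notation J := (C6 R).
Notation A := (C6_cubic R).
Implicit Types (u x : J).

Definition detC6 x : K := @norm3 R A x.

Lemma detC6_one : detC6 jone = 1.
Proof. exact: (@norm31 R A). Qed.

Lemma minimal_tripotent_sharp (p : J) : minimal_tripotent p -> @sharp R A p = 0.
Proof.
case=> pp pmin pn0; apply: (@minimal_sharp R A) => // x px.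
have : [set x | jtriple p p x = x]%classic x by exact: px.
by rewrite pmin => -[c _ <-]; exists c.
Qed.

Lemma spectral_sum u x (a : 'I_3 -> K) (p : 'I_3 -> J) : unitary u ->
  spectral_decomposition u x a p ->
  p ord0 + p (ordS ord0) + p (ordS (ordS ord0)) = u.
Proof.
move=> uu [pmin ple porth _].
have form1 j : @tform R A (p j) (jstar (p j)) = 1.
  have [pp _ pn0] := pmin j.
  exact: (@rank_one_form R A _ pn0 (minimal_tripotent_sharp (pmin j)) pp).
have trip j : jtriple (p j) (p j) (p j) = p j by case: (pmin j).
apply: (@frame_sum R A u _ _ _ uu).
- by split; exact: trip.
- by split; exact: form1.
- by split; exact: porth.
by move=> s; rewrite !inE => /or3P[] /eqP ->; exact: ple.
Qed.

(** Holds for complex coefficients and every unitary u, and so covers both stages of the definition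
    of the determinant. *)
Lemma det_spectral u x (a : 'I_3 -> K) (p : 'I_3 -> J) : unitary u ->
  spectral_decomposition u x a p -> detC6 x = (\prod_j a j) * detC6 u.
Proof.
move=> uu dec; rewrite -(spectral_sum uu dec).
have [pmin _ _ ->] := dec.
rewrite (big_ordS _ ord0) !big_ord_recl big_ord0 mulr1 mulrA.
have e1 : lift ord0 ord0 = ordS ord0 :> 'I_3 by apply/val_inj.
have e2 : lift ord0 (lift ord0 ord0) = ordS (ordS ord0) :> 'I_3 by apply/val_inj.
rewrite e1 e2.
exact: (@norm3_rank_one_sum R A _ _ _ _ _ _ (minimal_tripotent_sharp (pmin _))
  (minimal_tripotent_sharp (pmin _)) (minimal_tripotent_sharp (pmin _))).
Qed.

Definition triple_of (V : Type) (a b c : V) (j : 'I_3) : V :=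
  nth a [:: a; b; c] j.

Lemma frame_spectral x (a b c : K) (p q r : J) : @frame R A p q r ->
  x = a *: p + b *: q + c *: r ->
  spectral_decomposition jone x (triple_of a b c) (triple_of p q r).
Proof.
move=> f xE; have [pp qq rr _] := f.
have proj j : @rank_one_proj R A (triple_of p q r j).
  by case: j => [[|[|[|]]] ?].
split.
- move=> j; have pj := proj j; split.
  + exact: (@rank_one_proj_triple R A).
  + apply/seteqP; split=> [y /= py | y [d _ <-]].
      exists (@tform R A (triple_of p q r j) y) => //.
      by symmetry; exact: (@rank_one_proj_minimal R A).
    have [_ ps _] := pj.
    rewrite /=; have := @triple_idempotent R A _ (d *: triple_of p q r j)
      (rank_one_proj_mul pj) ps.
    by rewrite (@mulZr R A) (rank_one_proj_mul pj).
  have [_ _ t1] := pj; apply/eqP => p0; move: t1; rewrite p0.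
  by move/eqP; rewrite (@tr0 R A) eq_sym oner_eq0.
- by move=> j; exact: (@rank_one_proj_le R A).
(* The six ordered pairs of distinct indices need all six orderings of the frame. *)
- have f1 := frame_rot f; have f2 := frame_rot f1.
  have f3 := frame_swap f; have f4 := frame_rot f3; have f5 := frame_rot f4.
  case=> [[|[|[|]]] ?] // [[|[|[|]]] ?] // _; rewrite /tri_orthogonal /triple_of /=.
  + by apply: (@frame_orthogonal R A _ _ _ f).
  + by apply: (@frame_orthogonal R A _ _ _ f4).
  + by apply: (@frame_orthogonal R A _ _ _ f3).
  + by apply: (@frame_orthogonal R A _ _ _ f1).
  + by apply: (@frame_orthogonal R A _ _ _ f2).
  + by apply: (@frame_orthogonal R A _ _ _ f5).
by rewrite (big_ordS _ ord0) xE.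
Qed.

(** Minimality, order and orthogonality are expressed by linear structure and triple product alone,
    so T preserves them together with the coefficients. *)
Lemma spectral_transport (T : {linear J -> J}) u x (a : 'I_3 -> K) (p : 'I_3 -> J) :
  triple_automorphism T -> spectral_decomposition u x a p ->
  spectral_decomposition (T u) (T x) a (T \o p).
Proof.
move=> [[S TS ST] Tt] [pmin ple porth xE]; split.
- move=> j; have [pp pm pn0] := pmin j; split.
  + by rewrite /tripotent -Tt pp.
  + apply/seteqP; split=> [y /= | y [d _ <-]].
      rewrite -{1}[y]ST -Tt => /(congr1 S); rewrite TS => e.
      have : [set x | jtriple (p j) (p j) x = x]%classic (S y) by exact: e.
      by rewrite pm => -[d _ ey]; exists d => //; rewrite -linearZ ey ST.
    have : range (fun c : K => c *: p j)%classic (d *: p j) by exists d.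
    by rewrite -pm /= => e; rewrite -linearZ -Tt e.
  by apply: contra_neq pn0 => Tp0; apply: (can_inj TS); rewrite linear0; exact: Tp0.
- move=> j; have [le1 le2] := ple j; split.
    by rewrite /tripotent /= -linearB -Tt le1.
  by rewrite /tri_orthogonal /= -linearB -Tt le2 linear0.
- by move=> j k jk; rewrite /tri_orthogonal /= -Tt (porth j k jk) linear0.
by rewrite xE linear_sum; apply: eq_bigr => j _; rewrite linearZ.
Qed.

Lemma unitary_automorphism (T : {linear J -> J}) u :
  triple_automorphism T -> unitary u -> unitary (T u).
Proof. by move=> [[S TS ST] Tt] uu x; rewrite -[x]ST -Tt uu. Qed.

Lemma unitary_one : unitary (jone : J).
Proof.
move=> x; have := @triple_idempotent R A jone x (@mul1 R A jone) (@star1 R A).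
by rewrite (@mul1 R A).
Qed.

Lemma unitary_spectral_decomposition u : unitary u ->
  exists (a : 'I_3 -> K) (p : 'I_3 -> J),
  spectral_decomposition jone u a p /\ (forall j, `|a j| = 1).
Proof.
move=> uu; have [a [b [c [p [q [r [f uE [a1 b1 c1]]]]]]]] :=
  @unitary_spectral R A u uu.
exists (triple_of a b c), (triple_of p q r); split; first exact: frame_spectral.
by case=> [[|[|[|]]] ?].
Qed.

Lemma real_spectral_decomposition u x : unitary u -> x = jtriple u x u ->
  exists (a : 'I_3 -> R) p,
    spectral_decomposition u x (fun j => real_complex R (a j)) p.
Proof.
move=> uu xu; have [T [bT T1 Tt]] := @unitary_transport R A u uu.
have [y xE ys] := @unitary_reality R A u x T bT T1 Tt xu.
have [a [b [c [p [q [r [f yE]]]]]]] := self_adjoint_spectral ys.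
exists (triple_of a b c), (T \o triple_of p q r).
have hT : @triple_automorphism R T by split.
rewrite xE -T1; apply: (spectral_transport hT).
have [h1 h2 h3 h4] := frame_spectral f yE; split=> //.
rewrite h4; apply: eq_bigr => j _; congr (_ *: _).
by case: j => [[|[|[|]]] ?].
Qed.

Lemma det_automorphism (T : {linear J -> J}) u : triple_automorphism T ->
  unitary u -> detC6 (T u) = detC6 u * detC6 (T jone).
Proof.
move=> hT uu; have [a [p [dec _]]] := unitary_spectral_decomposition uu.
rewrite (det_spectral (unitary_automorphism hT unitary_one)
  (spectral_transport hT dec)).
by rewrite (det_spectral unitary_one dec) detC6_one mulr1.
Qed.

(** Every admissible value equals the norm, so the choice is harmless; existence of a decomposition
    excludes the default 0. *)
Lemma dt_unitaryE u : unitary u -> dt_unitary u = detC6 u.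
Proof.
move=> uu; rewrite /dt_unitary; case: xgetP => [d _ [a [p [dec _ ->]]] | none].
  by rewrite (det_spectral unitary_one dec) detC6_one mulr1.
have [a [p [dec a1]]] := unitary_spectral_decomposition uu.
by case: (none (\prod_j a j)); exists a, p.
Qed.

Lemma dt_atE u x : unitary u -> x = jtriple u x u ->
  dt_at u x * detC6 u = detC6 x.
Proof.
move=> uu xu; rewrite /dt_at; case: xgetP => [d _ [a [p [dec ->]]] | none].
  by rewrite (det_spectral uu dec).
have [a [p dec]] := real_spectral_decomposition uu xu.
by case: (none (\prod_j (real_complex R (a j)))); exists a, p.
Qed.

Lemma dtE u x : unitary u -> x = jtriple u x u -> dt x = detC6 x.
Proof.
move=> uu xu; rewrite /dt; case: xgetP => [d _ [v [vv xv ->]] | none].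
  by rewrite dt_unitaryE // dt_atE.
by case: (none (dt_at u x * dt_unitary u)); exists u.
Qed.

End Determinant.

Theorem proposition10p5 (R : realType) (T : {linear C6 R -> C6 R})
  (hT : triple_automorphism T) (x : C6 R) :
  dt (T x) = dt x * dt (T jone).
Proof.
have u1 := unitary_automorphism hT (@unitary_one R).
rewrite (dtE u1 (esym (u1 _))).
have [[u [uu xu]] | none] := pselect (exists u, unitary u /\ x = jtriple u x u).
  have [_ Tt] := hT; have Tu := unitary_automorphism hT uu.
  have Txu : T x = jtriple (T u) (T x) (T u) by rewrite -Tt -xu.
  rewrite (dtE uu xu) (dtE Tu Txu).
  have [a [p dec]] := real_spectral_decomposition uu xu.
  rewrite (det_spectral uu dec) (det_spectral Tu (spectral_transport hT dec)).
  by rewrite (det_automorphism hT uu) mulrA.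
(* The existence of a unitary u with x = {u, x, u} is invariant under T. In this branch it fails for
   both x and T x, and both determinants are the default 0. *)
have [[S TS ST] Tt] := hT.
have dt0 y : ~ (exists u, unitary u /\ y = jtriple u y u) -> dt y = 0.
  move=> noy; rewrite /dt; case: xgetP => // d _ [u [uu yu _]].
  by case: noy; exists u.
rewrite !dt0 ?mul0r // => -[u [uu xu]]; apply: none; exists (S u); split.
  by move=> y; apply: (can_inj TS); rewrite Tt ST uu.
by apply: (can_inj TS); rewrite Tt ST.
Qed.
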